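(* Let $D\subset\mathbb{C}^n$ be open and let $\mathcal{X}\subset\mathrm{Hol}(D)$ be a Banach space satisfying P1–P3 over $D$, with maximal domain $\hat D$. Let $\mathcal{Y}$ be a Banach space of analytic functions on an open set $E\subset\mathbb{C}^m$ satisfying P2 and P3 over $E$. Let $T:\mathcal{X}\to\mathcal{Y}$ be a bounded linear operator such that $Tf$ is cyclic in $\mathcal{Y}$ whenever $f$ is cyclic in $\mathcal{X}$. Then there exist analytic functions $a\in\mathcal{Y}$ and $b:E\to\hat D$ such that $Tf(u)=a(u)\hat f(b(u))$ for every $u\in E$ and $f\in\mathcal{X}$. Moreover, $a=T(1)$ is cyclic and $b=\frac{T(z)}{T(1)}$, where $T(z)$ is the $n$-tuple of functions $(T(z_i))_{i=1}^n$.
   Context: $\mathrm{Hol}(D)$ is the set of holomorphic functions on $D$. A Banach space $\mathcal{X}\subset\mathrm{Hol}(D)$, $D\subset\mathbb{C}^n$ open, satisfies: (P1) if the set $\mathcal{P}$ of polynomials in $n$ variables is a dense subset of $\mathcal{X}$; (P2) if $f\mapsto f(z)$ is a bounded linear functional on $\mathcal{X}$ for every $z\in D$; (P3) if for every $1\le i\le n$ the shift $S_i:\mathcal{X}\to\mathcal{X}$, $(S_if)(z)=z_if(z)$, is a (well-defined) bounded linear operator. P2 and P3 for $\mathcal{Y}$ over $E\subset\mathbb{C}^m$ are defined in the same way. The maximal domain of functions in $\mathcal{X}$ is $\hat D:=\{w\in\mathbb{C}^n:\ p\mapsto p(w),\ p\in\mathcal{P},\text{ has a bounded linear extension } \Lambda_w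 \text{ to } \mathcal{X}\}\supseteq D$. For $f\in\mathcal{X}$, $\hat f:\hat D\to\mathbb{C}$ is defined by $\hat f(w):=\Lambda_w f$ (so $\hat f|_D=f$). A function $f$ in $\mathcal{X}$ or $\mathcal{Y}$ is cyclic if the closed linear span of $\{z^\alpha f:\alpha\in\mathbb{Z}_{\ge0}^k\}$ ($k$ being the number of variables) is the whole space. $z_i$ denotes the $i$-th coordinate function. *)

(* Defs.v *)
From HB Require Import structures.
From mathcomp Require Import all_boot all_order all_algebra.
From mathcomp Require mpoly.
From mathcomp Require Import complex.
From mathcomp Require Import all_classical all_reals all_analysis.

Set Implicit Arguments.
Unset Strict Implicit.
Unset Printing Implicit Defensive.

Import Order.TTheory GRing.Theory Num.Theory numFieldNormedType.Exports.

Local Open Scope classical_set_scope.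
Local Open Scope ring_scope.

(* Packing R[i] as a numClosedFieldType gives it, and 'rV[Cplx R]_n, the
   topology and norm that MathComp-Analysis puts on every numFieldType. *)
Definition Cplx (R : realType) : numClosedFieldType := complex R.

Section Definitions.
Variable R : realType.
Local Notation C := (Cplx R).

(* Only used for open D; Frechet differentiability over C. *)
Definition holomorphic_on (V W : normedModType C) (D : set V) (g : V -> W) :=
  forall z, D z -> differentiable g z.

(* Functions on D are represented by total functions on C^n, of which only the
   values on D are meaningful: a Banach space contained in Hol(D) is a Banach
   space with a linear map into Hol(D) that is injective modulo equality on D. *)
Record holSpace (n : nat) (D : set 'rV[C]_n) := HolSpace {
  carrier :> completeNormedModType C ;
  ev : carrier -> 'rV[C]_n -> C ;
  ev_linear : forall (c : C) (f g : carrier) z, D z ->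
    ev (c *: f + g) z = c * ev f z + ev g z ;
  ev_inj : forall f g : carrier,
    (forall z, D z -> ev f z = ev g z) -> f = g ;
  ev_holomorphic : forall f : carrier, holomorphic_on D (ev f)
}.

Definition mpoly_fun (n : nat) (p : mpoly.mpoly n C) (z : 'rV[C]_n) : C :=
  mpoly.meval (fun i => z ord0 i) p.

Definition lin_span (V : lmodType C) (A : set V) : set V :=
  [set v | exists (k : nat) (c : 'I_k -> C) (a : 'I_k -> V),
     (forall i, A (a i)) /\ v = \sum_(i < k) c i *: a i].

Section Space.
Variables (n : nat) (D : set 'rV[C]_n) (X : holSpace D).

Definition represents (f : X) (g : 'rV[C]_n -> C) :=
  forall z, D z -> ev f z = g z.

(* The element of X equal to g on D; it is unique by [ev_inj]. The value is 0
   when g does not belong to X. *)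
Definition elt_of (g : 'rV[C]_n -> C) : X := xget 0 [set f : X | represents f g].

Definition P1 :=
  (forall p : mpoly.mpoly n C, exists f : X, represents f (mpoly_fun p)) /\
  dense [set f : X | exists p : mpoly.mpoly n C, represents f (mpoly_fun p)].

Definition P2 :=
  forall z, D z -> bounded_near (fun f : X => ev f z) (nbhs 0).

Definition P3 :=
  forall i : 'I_n, exists S : {linear X -> X},
    (forall f : X, represents (S f) (fun z => z ord0 i * ev f z)) /\
    bounded_near S (nbhs 0).

(* L is the functional written Lambda_w. *)
Definition eval_extension (w : 'rV[C]_n) (L : X -> C) :=
  [/\ linear L, bounded_near L (nbhs 0) &
      forall (p : mpoly.mpoly n C) (f : X),
        represents f (mpoly_fun p) -> L f = mpoly_fun p w].

Definition max_domain : set 'rV[C]_n :=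
  [set w | exists L : X -> C, eval_extension w L].

(* Lambda_w, for w in the maximal domain: it is unique there as soon as
   polynomials are dense in X. *)
Definition Lambda (w : 'rV[C]_n) : X -> C :=
  xget (fun=> 0) [set L : X -> C | eval_extension w L].

Definition hat (f : X) (w : 'rV[C]_n) : C := Lambda w f.

Definition cyclic_fun (f : X) :=
  closure (lin_span [set g : X | exists alpha : 'I_n -> nat,
    represents g (fun z => (\prod_(i < n) z ord0 i ^+ alpha i) * ev f z)])
  = setT.

End Space.
End Definitions.

Arguments ev {R n D h}.
Arguments elt_of {R n D} X g.
Arguments max_domain {R n D} X.

(* Main.v *)
Require Import Defs.
From HB Require Import structures.
From mathcomp Require Import all_boot all_order all_algebra.
From mathcomp Require Import -(notations) mpoly.
From mathcomp Require Import complex.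
From mathcomp Require Import all_classical all_reals all_analysis.
From mathcomp Require Import ring zify.

Set Implicit Arguments.
Unset Strict Implicit.
Unset Printing Implicit Defensive.

Import Order.TTheory GRing.Theory Num.Theory numFieldNormedType.Exports.

Local Open Scope classical_set_scope.
Local Open Scope ring_scope.

(** The proof has an algebraic half and an analytic half.

    Let u be a point of E with T1(u) <> 0. The functional sending a polynomial
    p to (Tp)(u) / T1(u) is bounded for the norm of X and takes the value 1 at
    1. It does not vanish at cyclic polynomials: every element of Y is a limit
    of multiples of the cyclic function Tp, so a zero of Tp at u would be a
    zero of T1 too. Such a functional Lam is multiplicative ([gkz_mul]). To
    see this, let p be a polynomial. For small t the polynomial (1 - t p)^N is
    cyclic for every N, because multiplication by 1 - t p has dense range.
    Hence Lam ((1 - t p)^N) is a polynomial in t, of degree at most N, whose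
    roots stay away from 0 uniformly in N. Comparing its coefficients of t and
    t^2 with the first two power sums of the inverses of its roots gives
    N Lam(p)^2 - (N - 1) Lam(p^2) = O(1), whence Lam(p^2) = Lam(p)^2, and
    polarization yields multiplicativity. So Lam is the evaluation at the point
    b(u) with coordinates (T z_i)(u) / T1(u), and since Lam is bounded, b(u)
    belongs to the maximal domain.

    It remains to define b at the zeros of T1. As T1 is cyclic, every h in Y is
    a limit of products q_k T1 with polynomials q_k. If T1 does not vanish
    identically near u, then on some complex line through u it has no zero on a
    small square around u; so the q_k converge uniformly on that square and on
    its translates to nearby points, hence, by Cauchy's estimates, near u. The
    limit is a quotient theta(., h) of h by T1, holomorphic near u and bounded
    as a functional of h ([quotient_functional]). With b_i = theta(., T z_i),
    the identity theta(u, Tp) = p(b(u)) extends by continuity from the points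
    where T1 does not vanish, and it puts b(u) in the maximal domain. On the
    set where T1 vanishes identically nearby, so does every element of Y, and b
    may be any constant point of D. By isolation of zeros
    ([zeros_cluster]) this set and its complement in E are both open, so b is
    holomorphic.

    Holomorphy is given as complex differentiability at each point, so the
    function theory rests on Goursat's lemma. Instead of line integrals it uses
    midpoint sums with 2^k terms per edge: these are exact on affine functions
    and additive under bisection, which is all that Goursat's argument needs.
    A limit along an ultrafilter turns the sums over a square into a linear
    functional, which yields Taylor expansions with explicit remainders
    ([taylor_functional]). *)

(** * Sequences, limits and differentiability over a normed field *)

Section ComplexAnalysis.
Variable C : numClosedFieldType.

Definition cauchy_seq (V : normedModType C) (u : nat -> V) :=
  forall e : C, 0 < e -> exists N, forall i j, (N <= i)%N -> (N <= j)%N ->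
    `|u i - u j| < e.

Definition lim_seq (V : normedModType C) (u : nat -> V) (l : V) :=
  forall e : C, 0 < e -> exists N, forall i, (N <= i)%N -> `|u i - l| < e.

Definition seq_complete (V : normedModType C) :=
  forall u : nat -> V, cauchy_seq u -> exists l, lim_seq u l.

(** The archimedean property, in the form in which geometric series use it. *)
Definition half_pow_null :=
  forall D e : C, 0 <= D -> 0 < e -> exists n, D / 2 ^+ n < e.

Lemma banach_complete (V : completeNormedModType C) : @seq_complete V.
Proof.
move=> u cu.
have /cauchy_cvg cvu : cauchy (u @ \oo).
  apply/cauchy_ballP => e e0; have [N hN] := cu _ e0.
  exists (u @` [set k | (N <= k)%N], u @` [set k | (N <= k)%N]) => /=.
    by split; exists N => // k /= Nk; exists k.
  by move=> [_ _] [[i Ni <-] [j Nj <-]]; rewrite -ball_normE; apply: hN.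
exists (lim (u @ \oo)) => e e0; move/cvgrPdist_lt : cvu => /(_ e e0) [N _ hN].
by exists N => i Ni; rewrite distrC; apply: hN.
Qed.

Hypothesis half_pow_small : half_pow_null.
Hypothesis C_complete : @seq_complete C.

(** Dependent choice along shrinking balls with halving radii. Goursat's
    bisection and the uniform boundedness argument are both instances: the
    state s carries the triangle, respectively the ball, and [Inv] what is
    preserved along the way. *)
Lemma nested_balls (V : normedModType C) (S : Type) (x : S -> V) (r : S -> C)
    (Inv : nat -> S -> Prop) (s0 : S) :
  seq_complete V -> Inv 0%N s0 -> 0 <= r s0 ->
  (forall n s, Inv n s -> 0 <= r s -> exists s', [/\ Inv n.+1 s',
     `|x s' - x s| + r s' <= r s, 0 <= r s' & r s' <= r s / 2]) ->
  exists (s : nat -> S) (z : V),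
    forall n, [/\ Inv n (s n), `|z - x (s n)| <= r (s n) & r (s n) <= r s0 / 2 ^+ n].
Proof.
move=> cV I0 r0 step.
have [next hnext] : exists next : nat -> S -> S, forall n s, Inv n s -> 0 <= r s ->
    [/\ Inv n.+1 (next n s), `|x (next n s) - x s| + r (next n s) <= r s,
        0 <= r (next n s) & r (next n s) <= r s / 2].
  have : forall ns : nat * S, exists s', Inv ns.1 ns.2 -> 0 <= r ns.2 ->
     [/\ Inv ns.1.+1 s', `|x s' - x ns.2| + r s' <= r ns.2, 0 <= r s' & r s' <= r ns.2 / 2].
    move=> [n s] /=; have [[I rs]|h] := pselect (Inv n s /\ 0 <= r s).
      by have [s' hs'] := step n s I rs; exists s'.
    by exists s0 => I rs; exfalso; apply: h.
  by move=> /choice[f hf]; exists (fun n s => f (n, s)) => n s; apply: (hf (n, s)).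
pose s := fix s n := if n is k.+1 then next k (s k) else s0.
have sI n : Inv n (s n) /\ 0 <= r (s n).
  elim: n => [//|n [In rn]] /=.
  by have [] := hnext n (s n) In rn.
have rs n : r (s n) <= r s0 / 2 ^+ n.
  elim: n => [|n IH]; first by rewrite expr0 divr1.
  have [In rn] := sI n; have [_ _ _ h] := hnext n (s n) In rn.
  apply: le_trans h _; rewrite exprSr invfM mulrA ler_pM2r ?invr_gt0 //.
have bnd n k : `|x (s (n + k)%N) - x (s n)| + r (s (n + k)%N) <= r (s n).
  elim: k => [|k IH]; first by rewrite addn0 subrr normr0 add0r.
  rewrite addnS; have [In rn] := sI (n + k)%N; have [_ h _ _] := hnext _ _ In rn.
  apply: le_trans IH; apply: le_trans (lerD (lexx _) h).
  by rewrite addrA lerD2r addrC ler_distD.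
have bnd' n i : (n <= i)%N -> `|x (s i) - x (s n)| <= r (s n).
  move=> ni; rewrite -(subnKC ni); apply: le_trans (bnd n (i - n)%N).
  by rewrite lerDl (sI _).2.
have /cV[z hz] : cauchy_seq (x \o s).
  move=> e e0; have e20 : 0 < e / 2 by rewrite divr_gt0.
  have [n hn] := half_pow_small r0 e20; exists n => i j ni nj /=.
  rewrite -(subrK (x (s n)) (x (s i))) -addrA.
  apply: le_lt_trans (ler_normD _ _) _; rewrite [X in _ < X](splitr e); apply: ltrD.
    by apply: le_lt_trans (bnd' _ _ ni) _; apply: le_lt_trans (rs n) _.
  by rewrite distrC; apply: le_lt_trans (bnd' _ _ nj) _; apply: le_lt_trans (rs n) _.
exists s, z => n; split; [exact: (sI n).1| |exact: rs].
rewrite real_leNgt ?normr_real ?ger0_real ?(sI n).2 //; apply/negP => h.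
have [N hN] := hz (`|z - x (s n)| - r (s n)) ltac:(by rewrite subr_gt0).
have := hN (maxn n N) (leq_maxr _ _); rewrite /= ltrBrDr => h1.
have := lerD (lexx `|x (s (maxn n N)) - z|) (bnd' n _ (leq_maxl n N)).
move=> /le_lt_trans/(_ h1); rewrite [`|_ - z|]distrC => h2.
suff : `|z - x (s n)| < `|z - x (s n)| by rewrite ltxx.
apply: le_lt_trans h2; rewrite -{1}(subrK (x (s (maxn n N))) z) -addrA.
exact: ler_normD.
Qed.

(** Passing to the limit in a bound that holds up to a geometrically small
    error. *)
Lemma lim_seq_dist (V : normedModType C) (s : nat -> V) (l c : V) (B D : C) :
  0 <= D -> B \is Num.real -> lim_seq s l -> (forall n, `|s n - c| <= B + D / 2 ^+ n) ->
  `|l - c| <= B.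
Proof.
move=> D0 Br sl hs; rewrite real_leNgt ?normr_real //; apply/negP => h.
pose d := (`|l - c| - B) / 2.
have d0 : 0 < d by rewrite divr_gt0 // subr_gt0.
have [N hN] := sl d d0; have [n hn] := half_pow_small D0 d0.
pose i := maxn N n.
have : `|l - c| < d + (B + d).
  apply: le_lt_trans (ler_distD (s i) _ _) _; apply: ltr_leD.
    by rewrite distrC; apply: hN; exact: leq_maxl.
  apply: le_trans (hs i) _; rewrite lerD2l; apply: le_trans (ltW hn).
  by rewrite ler_wpM2l // lef_pV2 ?posrE ?exprn_gt0 // ler_weXn2l ?ler1n // leq_maxr.
have -> : d + (B + d) = `|l - c| by rewrite /d; field.
by rewrite ltxx.
Qed.

Lemma lim_seq_lin (V : normedModType C) (s t : nat -> V) (l k : V) (c : C) :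
  lim_seq s l -> lim_seq t k -> lim_seq (fun n => c *: s n + t n) (c *: l + k).
Proof.
move=> sl tk d d0.
have c0 : 0 < `|c| + 1 by rewrite ltr_wpDl.
have d1 : 0 < d / 2 / (`|c| + 1) by rewrite !divr_gt0.
have d2 : 0 < d / 2 by rewrite divr_gt0.
have [N1 h1] := sl _ d1; have [N2 h2] := tk _ d2.
exists (maxn N1 N2) => i; rewrite geq_max => /andP[/h1 k1 /h2 k2].
rewrite opprD addrACA -scalerBr; apply: le_lt_trans (ler_normD _ _) _.
rewrite [X in _ < X]splitr ler_ltD // normrZ.
apply: (@le_trans _ _ ((`|c| + 1) * `|s i - l|)); first by rewrite ler_wpM2r // lerDl.
by rewrite mulrC -ler_pdivlMr // ltW.
Qed.

Lemma lim_seq_uniq (V : normedModType C) (s : nat -> V) (l k : V) :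
  lim_seq s l -> lim_seq s k -> l = k.
Proof.
move=> sl sk; apply/eqP; rewrite -subr_eq0 -normr_le0 real_leNgt ?normr_real //.
apply/negP => h; have d2 : 0 < `|l - k| / 2 by rewrite divr_gt0.
have [N1 h1] := sl _ d2; have [N2 h2] := sk _ d2.
suff : `|l - k| < `|l - k| by rewrite ltxx.
apply: le_lt_trans (ler_distD (s (maxn N1 N2)) _ _) _.
by rewrite [X in _ < X]splitr distrC ltrD ?h1 ?h2 ?leq_maxl ?leq_maxr.
Qed.

Lemma fast_cauchy (V : normedModType C) (s : nat -> V) (D : C) : 0 <= D ->
  (forall i j, `|s i - s j| <= D * (2 ^- i + 2 ^- j)) -> cauchy_seq s.
Proof.
move=> D0 hs d d0; have D2 : 0 <= D * 2 by rewrite mulr_ge0.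
have [N hN] := half_pow_small D2 d0; exists N => i j Ni Nj.
apply: le_lt_trans (hs i j) _; apply: le_lt_trans hN; rewrite -mulrA ler_wpM2l //.
have -> : 2 / 2 ^+ N = 2 ^- N + 2 ^- N :> C by ring.
by apply: lerD; rewrite lef_pV2 ?posrE ?exprn_gt0 // ler_weXn2l // ler1n.
Qed.

(** This and the next lemma translate between the little-o form of
    differentiability and explicit bounds. *)
Lemma differentiable_approx (V W : normedModType C) (F : V -> W) (z : V) :
  differentiable F z -> forall e : C, 0 < e -> exists2 d : C, 0 < d &
    forall h, `|h| < d -> `|F (h + z) - F z - 'd F z h| <= e * `|h|.
Proof.
move=> dF e e0.
have /eqaddoP h := diff_locally dF.
have /nbhs_norm0P[d /= d0 hd] := h e e0.
exists d => // x xd; have := hd x xd.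
by rewrite /= opprD addrA.
Qed.

Lemma approx_differentiable (V W : normedModType C) (F : V -> W) (z : V)
    (L : {linear V -> W}) : continuous L ->
  (forall e : C, 0 < e -> exists2 d : C, 0 < d &
    forall h, `|h| < d -> `|F (h + z) - F z - L h| <= e * `|h|) ->
  differentiable F z.
Proof.
move=> cL hF.
have h : F \o shift z = cst (F z) + L +o_ 0 id.
  apply/eqaddoP => e e0; have [d d0 hd] := hF e e0.
  apply/nbhs_norm0P; exists d => //= x xd; have := hd x xd.
  by rewrite /= opprD addrA.
by apply/diff_locallyP; rewrite (diff_unique cL h).
Qed.

Lemma differentiable_near (V W : normedModType C) (f : V -> W) u : differentiable f u ->
  forall d : C, 0 < d -> exists2 r : C, 0 < r & forall w, `|w - u| < r -> `|f w - f u| < d.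
Proof.
move=> /differentiable_continuous cf d d0.
have /cvgrPdist_lt/(_ d d0)/nbhs_normP[r /= r0 hr] : f @ u --> f u by exact: cf.
exists r => // w wr; rewrite distrC; apply: hr => /=; by rewrite distrC.
Qed.

Lemma min_pos (a b : C) : 0 < a -> 0 < b -> exists c : C, [/\ 0 < c, c <= a & c <= b].
Proof.
move=> a0 b0; have [a1 b1] : 0 < a^-1 /\ 0 < b^-1 by rewrite !invr_gt0.
exists (a^-1 + b^-1)^-1; split; first by rewrite invr_gt0 addr_gt0.
  by rewrite invf_ple ?posrE ?addr_gt0 // lerDl ltW.
by rewrite invf_ple ?posrE ?addr_gt0 // lerDr ltW.
Qed.

Lemma diff_scalar (F : C -> C) (z x : C) :
  differentiable F z -> 'd F z x = x * 'd F z 1.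
Proof. by move=> dF; rewrite diff1E //= scale1r. Qed.

Lemma near_differentiable (V W : normedModType C) (f f' : V -> W) (u : V) (r : C) : 0 < r ->
  (forall w, `|w - u| < r -> f w = f' w) -> differentiable f u -> differentiable f' u.
Proof.
move=> r0 ff' df; apply: (@approx_differentiable _ _ f' u ('d f u)).
  exact: diff_continuous.
move=> e e0; have [d d0 hd] := differentiable_approx df e0.
have [s [s0 sr sd]] := min_pos r0 d0; exists s => // h hs.
rewrite -!ff' ?subrr ?normr0 //; last by rewrite addrK (lt_le_trans hs).
by apply: hd; exact: lt_le_trans hs sd.
Qed.

Lemma differentiable_row (V : normedModType C) (n : nat) (f : 'I_n -> V -> C) (u : V) :
  (forall i, differentiable (f i) u) -> differentiable (fun w => \row_i f i w) u.
Proof.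
move=> df; rewrite (_ : (fun w => _) = \sum_(i < n) (fun w => f i w *: delta_mx 0 i : 'rV[C]_n)).
  by apply: differentiable_sum => i; apply: differentiableZl.
apply/funext => w; rewrite fct_sumE [LHS]row_sum_delta; apply: eq_bigr => i _.
by rewrite mxE.
Qed.

Lemma differentiable_lin (V : normedModType C) (c : C)
  (f g : V -> C) x : differentiable f x -> differentiable g x ->
  differentiable (fun w => c * f w + g w) x.
Proof.
move=> df dg; have := differentiableD (differentiableZ c df) dg.
by rewrite (_ : c *: f + g = fun w => c * f w + g w).
Qed.

Lemma differentiable_mul (V : normedModType C)
  (f g : V -> C) x : differentiable f x -> differentiable g x ->
  differentiable (fun w => f w * g w) x.
Proof. exact: differentiableM. Qed.

(** * Goursat's lemma for midpoint sums *)

Definition null (s : nat -> C) := lim_seq s 0.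

Lemma nullP (s : nat -> C) :
  null s <-> forall e, 0 < e -> exists N, forall i, (N <= i)%N -> `|s i| < e.
Proof.
split=> h e e0; have [N hN] := h e e0; exists N => i Ni; first by rewrite -[s i]subr0 hN.
by rewrite subr0 hN.
Qed.

Lemma nullD (s t : nat -> C) : null s -> null t -> null (fun k => s k + t k).
Proof.
move=> /nullP hs /nullP ht; apply/nullP => e e0.
have e20 : 0 < e / 2 by rewrite divr_gt0.
have [N1 h1] := hs _ e20; have [N2 h2] := ht _ e20.
exists (maxn N1 N2) => i; rewrite geq_max => /andP[/h1 k1 /h2 k2].
by apply: le_lt_trans (ler_normD _ _) _; rewrite (splitr e) ltrD.
Qed.

Lemma nullE (s t : nat -> C) : s =1 t -> null s -> null t.
Proof. by move=> /funext ->. Qed.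

Local Notation mid p q := ((p + q) / 2 : C).

(** Closure under midpoints suffices here: every sampling point of a midpoint
    sum arises from the end points by iterated bisection. *)
Definition midconvex (K : set C) := forall p q, K p -> K q -> K (mid p q).

(** The midpoint rule with 2^k nodes for the integral of F dz along the
    segment from p to q. Defining it by bisection makes additivity under
    bisection definitional, at the price of one level. *)
Fixpoint midsum (F : C -> C) (k : nat) (p q : C) : C :=
  if k is k'.+1 then midsum F k' p (mid p q) + midsum F k' (mid p q) q
  else (q - p) * F (mid p q).

Lemma midsum_lin F G (c : C) k p q :
  midsum (fun z => c * F z + G z) k p q = c * midsum F k p q + midsum G k p q.
Proof.
by elim: k p q => [|k IH] p q /=; rewrite ?IH; ring.
Qed.

Lemma midsumB F G k p q :
  midsum (fun z => F z - G z) k p q = midsum F k p q - midsum G k p q.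
Proof.
by elim: k p q => [|k IH] p q /=; rewrite ?IH; ring.
Qed.

Lemma midsumC F k p q : midsum F k q p = - midsum F k p q.
Proof.
elim: k p q => [|k IH] p q /=; first by rewrite [q + p]addrC; ring.
by rewrite (IH (mid q p) q) (IH p (mid q p)) [q + p]addrC; ring.
Qed.

(** The midpoint rule is exact on affine functions, so that sums over closed
    polygons of affine functions vanish at every level, and not merely in the
    limit. *)
Lemma midsum_affine (a b : C) k p q :
  midsum (fun z => a + b * z) k p q = a * (q - p) + b * (q ^+ 2 - p ^+ 2) / 2.
Proof. by elim: k p q => [|k IH] p q /=; rewrite ?IH; field. Qed.

Lemma eq_midsum (K : set C) F G k p q : midconvex K -> K p -> K q ->
  (forall z, K z -> F z = G z) -> midsum F k p q = midsum G k p q.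
Proof.
move=> mK Kp Kq FG; elim: k p q Kp Kq => [|k IH] p q Kp Kq /=.
  by rewrite FG //; apply: mK.
by rewrite !IH //; apply: mK.
Qed.

Lemma midB1 (p q : C) : mid p q - p = (q - p) / 2. Proof. by field. Qed.
Lemma midB2 (p q : C) : q - mid p q = (q - p) / 2. Proof. by field. Qed.

Lemma norm_half (z : C) : `|z / 2| = `|z| / 2.
Proof. by rewrite normrM normfV [`|2 : C|]ger0_norm. Qed.

Lemma midsum_le (K : set C) F M k p q : midconvex K -> K p -> K q ->
  (forall z, K z -> `|F z| <= M) -> `|midsum F k p q| <= M * `|q - p|.
Proof.
move=> mK + + FM; elim: k p q => [|k IH] p q Kp Kq /=.
  by rewrite normrM mulrC ler_wpM2r //; apply/FM/mK.
apply: le_trans (ler_normD _ _) _.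
have Km := mK _ _ Kp Kq.
apply: le_trans (lerD (IH _ _ Kp Km) (IH _ _ Km Kq)) _.
by rewrite midB1 midB2 norm_half -mulrDr -splitr.
Qed.

(** An average of numbers lies in every half plane that contains them. *)
Lemma midsum_Im_ge (K : set C) F c k p q : midconvex K -> K p -> K q ->
  (forall z, K z -> c <= 'Im ((q - p) * F z)) -> c <= 'Im (midsum F k p q).
Proof.
move=> mK; elim: k c p q => [|k IH] c p q Kp Kq h /=; first by apply: h; apply: mK.
have Km := mK _ _ Kp Kq.
rewrite raddfD /= (splitr c); apply: lerD; apply: IH => // z Kz.
  rewrite midB1 mulrAC -[2^-1]/((1 + 1)^-1).
  have -> : (q - p) * F z / (1 + 1) = 2^-1 * ((q - p) * F z) by rewrite mulrC.
  rewrite ImMl ?rpredV ?rpred_nat // mulrC ler_pM2l ?invr_gt0 //; exact: h.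
rewrite midB2 mulrAC.
have -> : (q - p) * F z / 2 = 2^-1 * ((q - p) * F z) by rewrite mulrC.
rewrite ImMl ?rpredV ?rpred_nat // mulrC ler_pM2l ?invr_gt0 //; exact: h.
Qed.

Definition trisum F k p q r := midsum F k p q + midsum F k q r + midsum F k r p.

(** The sums along the three inner edges of the subdivided triangle cancel in
    pairs, exactly, since the midpoint rule is odd in the orientation. *)
Lemma trisumS F k p q r : trisum F k.+1 p q r =
  trisum F k p (mid p q) (mid r p) + trisum F k (mid p q) q (mid q r)
  + trisum F k (mid r p) (mid q r) r + trisum F k (mid p q) (mid q r) (mid r p).
Proof.
rewrite /trisum /= (midsumC F k (mid p q) (mid r p)).
rewrite (midsumC F k (mid q r) (mid p q)) (midsumC F k (mid r p) (mid q r)).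
ring.
Qed.

Lemma trisum_le (K : set C) F M k p q r : midconvex K -> K p -> K q -> K r ->
  (forall z, K z -> `|F z| <= M) ->
  `|trisum F k p q r| <= M * (`|q - p| + `|r - q| + `|p - r|).
Proof.
move=> mK Kp Kq Kr FM; rewrite !mulrDr.
apply: le_trans (ler_normD _ _) _; apply: lerD; last exact: (midsum_le (K := K)).
by apply: le_trans (ler_normD _ _) _; apply: lerD; exact: (midsum_le (K := K)).
Qed.

Lemma ball_midconvex (c : C) (r : C) : midconvex [set z | `|z - c| <= r].
Proof.
move=> p q /= pr qr.
have -> : mid p q - c = (p - c) / 2 + (q - c) / 2 by field.
apply: le_trans (ler_normD _ _) _; rewrite !norm_half (splitr r).
by apply: lerD; rewrite ler_pM2r ?invr_gt0.
Qed.

Definition seq_closed (K : set C) :=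
  forall z, (forall e, 0 < e -> exists2 y, K y & `|y - z| < e) -> K z.

(** The negation of convergence to 0 of the sums over a triangle. In this form
    it passes to one of the four subtriangles, with a quarter of the bound. *)
Definition frequently_large (F : C -> C) (e : C) (p q r : C) :=
  forall N, exists2 k, (N <= k)%N & e <= `|trisum F k p q r|.

Lemma not_frequently_large F e p q r : 0 < e -> ~ frequently_large F e p q r ->
  exists N, forall k, (N <= k)%N -> `|trisum F k p q r| < e.
Proof.
move=> e0 /existsNP[N /forall2NP hN]; exists N => k Nk.
rewrite real_ltNge ?normr_real ?gtr0_real //.
by case: (hN k) => [//|] /negP.
Qed.

Lemma frequently_large_child F e p q r : 0 < e -> frequently_large F e p q r ->
  exists t, [/\ frequently_large F (e / 4) t.1.1 t.1.2 t.2 &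
     t = (p, mid p q, mid r p) \/ t = (mid p q, q, mid q r) \/
     t = (mid r p, mid q r, r) \/ t = (mid p q, mid q r, mid r p)].
Proof.
move=> e0 hb; apply: contrapT => hn.
have e40 : 0 < e / 4 by rewrite divr_gt0.
have h t : t = (p, mid p q, mid r p) \/ t = (mid p q, q, mid q r) \/
     t = (mid r p, mid q r, r) \/ t = (mid p q, mid q r, mid r p) ->
     ~ frequently_large F (e / 4) t.1.1 t.1.2 t.2.
  by move=> ht b; apply: hn; exists t.
have [N1 h1] := not_frequently_large e40 (h (p, mid p q, mid r p) ltac:(by left)).
have [N2 h2] := not_frequently_large e40 (h (mid p q, q, mid q r) ltac:(by right; left)).
have [N3 h3] := not_frequently_large e40 (h (mid r p, mid q r, r) ltac:(by right; right; left)).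
have [N4 h4] := not_frequently_large e40 (h (mid p q, mid q r, mid r p) ltac:(by right; right; right)).
have [[//|k]] := hb (N1 + N2 + N3 + N4).+1.
rewrite ltnS => Nk; rewrite trisumS => hk.
suff : e < e by rewrite ltxx.
apply: le_lt_trans hk _.
have -> : e = e / 4 + e / 4 + e / 4 + e / 4 by field.
apply: le_lt_trans (ler_normD _ _) _; apply: ltrD; [
  apply: le_lt_trans (ler_normD _ _) _; apply: ltrD; [
  apply: le_lt_trans (ler_normD _ _) _; apply: ltrD |] |].
- by apply: h1; lia.
- by apply: h2; lia.
- by apply: h3; lia.
- by apply: h4; lia.
Qed.

(** Goursat's bisection argument. If the sums did not tend to 0, then some
    nested sequence of triangles, with diameters of order 2^-n, would carry
    sums of size at least e / 4^n. At the common point F is affine up to an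
    error that is small with respect to the distance, and the affine part
    contributes exactly 0, so that the sums are at most a small multiple of
    4^-n. *)
Lemma goursat (K : set C) F p q r : midconvex K -> seq_closed K ->
  (forall z, K z -> differentiable F z) -> K p -> K q -> K r ->
  null (fun k => trisum F k p q r).
Proof.
move=> mK cK dF Kp Kq Kr; apply: contrapT => nn.
have [e e0 be] : exists2 e, 0 < e & frequently_large F e p q r.
  apply: contrapT => ne; apply: nn; apply/nullP => e e0; apply: not_frequently_large => //.
  by move=> b; apply: ne; exists e.
pose D : C := `|q - p| + `|r - q| + `|p - r| + 1.
have D0 : 0 < D by rewrite ltr_wpDl // !addr_ge0.
have pw n : 0 < (2 : C) ^+ n by rewrite exprn_gt0.
pose Inv n (s : nat * (C * C * C)) :=
  [/\ s.1 = n, [/\ K s.2.1.1, K s.2.1.2 & K s.2.2],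
  [/\ `|s.2.1.2 - s.2.1.1| <= D / 2 ^+ n, `|s.2.2 - s.2.1.2| <= D / 2 ^+ n &
      `|s.2.1.1 - s.2.2| <= D / 2 ^+ n] &
      frequently_large F (e / 4 ^+ n) s.2.1.1 s.2.1.2 s.2.2].
have [] := @nested_balls C _ (fun s => s.2.1.1)
    (fun s => D *+ 2 / 2 ^+ s.1) Inv (0%N, (p, q, r)) C_complete.
- rewrite /Inv /= expr0 !divr1; split=> //; split.
  + by rewrite /D -!addrA lerDl !addr_ge0.
  + by rewrite /D -!addrA ler_wpDl // lerDl addr_ge0.
  + by rewrite /D -addrA ler_wpDl ?addr_ge0 // lerDl.
- by rewrite /= expr0 divr1 mulrn_wge0 // ltW.
- move=> n [_ [[p' q'] r']] [/= -> [Kp' Kq' Kr'] [d1 d2 d3] b] _.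
  have en0 : 0 < e / 4 ^+ n by rewrite divr_gt0 ?exprn_gt0.
  have [t [bt ht]] := frequently_large_child en0 b.
  have hD : D / 2 ^+ n.+1 = D / 2 ^+ n / 2 by rewrite exprSr invfM mulrA.
  have d1' : `|p' - q'| <= D / 2 ^+ n by rewrite distrC; exact: d1.
  have d2' : `|q' - r'| <= D / 2 ^+ n by rewrite distrC; exact: d2.
  have d3' : `|r' - p'| <= D / 2 ^+ n by rewrite distrC; exact: d3.
  have hh x : `|x| <= D / 2 ^+ n -> `|x / 2| <= D / 2 ^+ n.+1.
    by rewrite hD norm_half ler_pM2r // invr_gt0.
  have hE : [/\ K t.1.1, K t.1.2 & K t.2] /\
     [/\ `|t.1.2 - t.1.1| <= D / 2 ^+ n.+1, `|t.2 - t.1.2| <= D / 2 ^+ n.+1 &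
         `|t.1.1 - t.2| <= D / 2 ^+ n.+1] /\ `|t.1.1 - p'| <= D / 2 ^+ n.+1.
    move: (D / 2 ^+ n.+1) hh => e1 hh.
    case: ht => [|[|[|]]] ->/=; split; (try by split=> //; apply: mK);
      (split; [split|]).
    + by rewrite midB1; apply: hh.
    + have -> : mid r' p' - mid p' q' = (r' - q') / 2 by field.
      exact: hh.
    + have -> : p' - mid r' p' = (p' - r') / 2 by field.
      exact: hh.
    + by rewrite subrr -(mul0r 2^-1); apply: hh; rewrite normr0 (le_trans _ d1).
    + by rewrite midB2; apply: hh.
    + have -> : mid q' r' - q' = (r' - q') / 2 by field.
      exact: hh.
    + have -> : mid p' q' - mid q' r' = (p' - r') / 2 by field.
      exact: hh.
    + by rewrite midB1; apply: hh.
    + have -> : mid q' r' - mid r' p' = (q' - p') / 2 by field.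
      exact: hh.
    + by rewrite midB2; apply: hh.
    + have -> : mid r' p' - r' = (p' - r') / 2 by field.
      exact: hh.
    + have -> : mid r' p' - p' = (r' - p') / 2 by field.
      exact: hh.
    + have -> : mid q' r' - mid p' q' = (r' - p') / 2 by field.
      exact: hh.
    + have -> : mid r' p' - mid q' r' = (p' - q') / 2 by field.
      exact: hh.
    + have -> : mid p' q' - mid r' p' = (q' - r') / 2 by field.
      exact: hh.
    + by rewrite midB1; apply: hh.
  have [hK [hd hp]] := hE; exists (n.+1, t); split => //=.
  + by split => //=; rewrite exprSr invfM mulrA.
  + apply: le_trans (lerD hp (lexx _)) _; rewrite hD exprSr invfM.
    have -> : D / 2 ^+ n / 2 + D *+ 2 * ((2 ^+ n)^-1 / 2) = (D / 2 ^+ n) * (3 / 2).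
      by field; rewrite expf_neq0 // pnatr_eq0.
    have -> : D *+ 2 / 2 ^+ n = (D / 2 ^+ n) * 2 by ring.
    rewrite ler_pM2l ?divr_gt0 // ler_pdivrMr // -natrM ler_nat //.
  + by rewrite divr_ge0 ?mulrn_wge0 // ltW.
  + by rewrite exprSr invfM mulrA.
move=> s [z hs].
have Kz : K z.
  apply: cK => d d0.
  have [n hn] := half_pow_small (D := D *+ 2) (mulrn_wge0 _ (ltW D0)) d0.
  have [[_ [K1 _ _] _ _]] := hs n; rewrite /= expr0 divr1 => h1 h2.
  exists (s n).2.1.1 => //; rewrite distrC; apply: le_lt_trans h1 _.
  exact: le_lt_trans h2 hn.
(* Each triangle has perimeter at most 3 D / 2^n and lies within 3 D / 2^n of
   z, so any constant above 9 in place of 10 would do. *)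
pose eta : C := e / (10 * D ^+ 2).
have eta0 : 0 < eta by rewrite divr_gt0 // mulr_gt0 // exprn_gt0.
have [d d0 hd] := differentiable_approx (dF z Kz) eta0.
have [n hn] := half_pow_small (D := D *+ 3) (mulrn_wge0 _ (ltW D0)) d0.
have [[_ _ [d1 d2 d3] b]] := hs n; rewrite /= expr0 divr1 => h1 h2.
have {h2 h1} h3 := le_trans h1 h2.
pose A := 'd F z 1.
have hA x : 'd F z x = x * A.
  by rewrite diff1E; [rewrite /A diff1E /= ?scale1r //; exact: dF | exact: dF].
pose B : set C := [set y | `|y - z| <= D *+ 3 / 2 ^+ n].
have D3 : D *+ 3 / 2 ^+ n = D *+ 2 / 2 ^+ n + D / 2 ^+ n by ring.
have Dn0 : 0 <= D / 2 ^+ n by rewrite divr_ge0 ?ltW.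
have Bp : B (s n).2.1.1.
  by rewrite /B /= distrC D3; apply: le_trans h3 _; rewrite lerDl.
have Bq : B (s n).2.1.2.
  rewrite /B /=; apply: le_trans (ler_distD (s n).2.1.1 _ _) _.
  by rewrite D3 addrC lerD // distrC.
have Br : B (s n).2.2.
  rewrite /B /=; apply: le_trans (ler_distD (s n).2.1.1 _ _) _.
  by rewrite D3 addrC lerD // distrC.
have [k _ hk] := b 0%N.
have aff : trisum (fun y => (F z - A * z) + A * y) k (s n).2.1.1 (s n).2.1.2 (s n).2.2 = 0.
  by rewrite /trisum !midsum_affine; field.
have : `|trisum F k (s n).2.1.1 (s n).2.1.2 (s n).2.2| <=
   (eta * (D *+ 3 / 2 ^+ n)) * (D *+ 3 / 2 ^+ n).
  rewrite -[X in `|X|]subr0 -{1}aff.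
  have -> : trisum F k (s n).2.1.1 (s n).2.1.2 (s n).2.2 -
      trisum (fun y => (F z - A * z) + A * y) k (s n).2.1.1 (s n).2.1.2 (s n).2.2 =
      trisum (fun y => F y - ((F z - A * z) + A * y)) k (s n).2.1.1 (s n).2.1.2 (s n).2.2.
    by rewrite /trisum !midsumB; ring.
  apply: le_trans (trisum_le k (@ball_midconvex z (D *+ 3 / 2 ^+ n)) Bp Bq Br
     (M := eta * (D *+ 3 / 2 ^+ n)) _) _.
    move=> y yB; have := hd (y - z) (le_lt_trans yB hn).
    rewrite subrK => h; have -> : F y - (F z - A * z + A * y) = F y - F z - 'd F z (y - z).
      by rewrite hA; ring.
    by apply: le_trans h _; rewrite ler_pM2l.
  rewrite ler_pM2l; last by rewrite mulr_gt0 // divr_gt0 // mulrn_wgt0.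
  have -> : D *+ 3 / 2 ^+ n = D / 2 ^+ n + D / 2 ^+ n + D / 2 ^+ n by ring.
  by apply: lerD => //; apply: lerD.
move=> /(le_trans hk).
have -> : eta * (D *+ 3 / 2 ^+ n) * (D *+ 3 / 2 ^+ n) = e / 4 ^+ n * (9 / 10).
  rewrite /eta; have -> : (4 : C) ^+ n = 2 ^+ n * 2 ^+ n by rewrite -exprMn -natrM.
  by field; rewrite (gt_eqF D0) expf_neq0 // pnatr_eq0.
rewrite ler_pMr ?divr_gt0 ?exprn_gt0 // ler_pdivlMr // mul1r ler_nat //.
Qed.

Lemma trisum_vertexS F k a p q : trisum F k.+1 a p q =
  trisum F k a (mid a p) (mid a q) +
  (trisum F k (mid a p) p (mid p q) + trisum F k (mid a q) (mid p q) q
  + trisum F k (mid a p) (mid p q) (mid a q)).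
Proof. by rewrite trisumS [q + a]addrC; ring. Qed.

(** Goursat's lemma for a triangle with an exceptional vertex a, near which F
    is only bounded. Of the four subtriangles only the one at a fails to be
    covered by the first hypothesis; iterating, the sum is asymptotically that
    of an arbitrarily small triangle at a, where boundedness is enough. *)
Lemma goursat_vertex (L : set C) (F : C -> C) (M rho a p q : C) :
  (forall x y z, L x -> L y -> L z -> null (fun k => trisum F k x y z)) ->
  midconvex L -> (forall x, L x -> L (mid a x)) ->
  0 < rho -> (forall z, `|z - a| <= rho -> `|F z| <= M) ->
  L p -> L q -> null (fun k => trisum F k a p q).
Proof.
move=> hG mL aL rho0 FM Lp Lq.
(* The homothety of ratio 2^-n with centre a. *)
pose half n (x : C) := a + (x - a) / 2 ^+ n.
pose E p q e := forall e', 0 < e' -> exists N, forall k, (N <= k)%N ->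
  `|trisum F k a p q| < e + e'.
have Ehalf p' q' e : L p' -> L q' -> E (mid a p') (mid a q') e -> E p' q' e.
  move=> Lp' Lq' h e' e'0; have e20 : 0 < e' / 2 by rewrite divr_gt0.
  have [N1 h1] := h _ e20.
  have Lap := aL _ Lp'; have Laq := aL _ Lq'; have Lpq := mL _ _ Lp' Lq'.
  have /nullP/(_ _ e20)[N2 h2] := nullD (nullD (hG _ _ _ Lap Lp' Lpq) (hG _ _ _ Laq Lpq Lq'))
    (hG _ _ _ Lap Lpq Laq).
  exists (maxn N1 N2).+1 => -[//|k]; rewrite ltnS geq_max => /andP[/h1 k1 /h2 k2].
  rewrite trisum_vertexS; apply: le_lt_trans (ler_normD _ _) _.
  by apply: lt_le_trans (ltrD k1 k2) _; rewrite -addrA -splitr.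
have halfS n x : half n.+1 x = half n (mid a x).
  by rewrite /half exprSr; field; rewrite expf_neq0 // pnatr_eq0.
have En n : forall p' q' e, L p' -> L q' -> E (half n p') (half n q') e -> E p' q' e.
  elim: n => [|n IH] p' q' e Lp' Lq'.
    by rewrite /half expr0 !divr1 !(addrC a) !subrK.
  by rewrite !halfS => /(IH _ _ _ (aL _ Lp') (aL _ Lq')); apply: Ehalf.
apply/nullP => e e0; have e20 : 0 < e / 2 by rewrite divr_gt0.
have M0 : 0 <= M.
  by have := FM a; rewrite subrr normr0 => /(_ (ltW rho0)); apply: le_trans.
pose P : C := `|p - a| + `|q - p| + `|a - q|.
have P0 : 0 <= P by rewrite !addr_ge0.
have [n1 hn1] := half_pow_small P0 rho0.
have [n2 hn2] := half_pow_small (mulr_ge0 M0 P0) e20.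
pose n := (n1 + n2)%N.
have mono (D : C) i j : 0 <= D -> (i <= j)%N -> D / 2 ^+ j <= D / 2 ^+ i.
  move=> D0 ij; rewrite ler_wpM2l // lef_pV2 ?posrE ?exprn_gt0 //.
  by rewrite ler_weXn2l // ler1n.
have nh (x : C) : `|x / 2 ^+ n| = `|x| / 2 ^+ n.
  by rewrite normrM normfV normrX [`|2 : C|]ger0_norm.
suff [N hN] : exists N, forall k, (N <= k)%N -> `|trisum F k a p q| < M * P / 2 ^+ n + e / 2.
  exists N => k /hN h; apply: lt_trans h _; rewrite [X in _ < X](splitr e) ltrD2r.
  by apply: le_lt_trans hn2; apply: mono; rewrite ?mulr_ge0 ?leq_addl.
apply: (@En n p q _ Lp Lq _ _ e20) => e' e'0; exists 0%N => k _.
have B x : `|x - a| <= P -> `|half n x - a| <= rho.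
  move=> h; rewrite /half [a + _]addrC addrK nh ltW //.
  apply: le_lt_trans hn1; apply: (@le_trans _ _ (P / 2 ^+ n)).
    by rewrite ler_wpM2r ?invr_ge0 ?exprn_ge0.
  by apply: mono => //; rewrite leq_addr.
have Ba : [set z | `|z - a| <= rho] a by rewrite /= subrr normr0 ltW.
have Bp : [set z | `|z - a| <= rho] (half n p).
  by apply: B; rewrite /P -addrA lerDl addr_ge0.
have Bq : [set z | `|z - a| <= rho] (half n q).
  by apply: B; rewrite /P distrC lerDr addr_ge0.
apply: le_lt_trans (trisum_le k (@ball_midconvex a rho) Ba Bp Bq FM) _.
have -> : half n p - a = (p - a) / 2 ^+ n by rewrite /half [a + _]addrC addrK.
have -> : a - half n q = (a - q) / 2 ^+ n by rewrite /half; ring.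
have -> : half n q - half n p = (q - p) / 2 ^+ n by rewrite /half; ring.
by rewrite !nh -!mulrDl mulrA ltrDl.
Qed.

(** * Cauchy's formula and Taylor expansion on a square *)

(** Vertices and edges of the square with vertices 1 - i, 1 + i, -1 + i, -1 -
    i, traversed counterclockwise. The index runs over all natural numbers and
    is periodic modulo 4, which avoids treating the last edge separately. *)
Definition square_vertex (l : nat) : C := 'i ^+ l * (1 - 'i).

Definition square_edge (l : nat) : set C :=
  [set z | exists2 y : C, -1 <= y <= 1 & z = 'i ^+ l * (1 + 'i * y)].

Definition square_bd : set C := [set z | exists l, square_edge l z].

Definition square_sum F k : C := \sum_(l < 4) midsum F k (square_vertex l) (square_vertex l.+1).

Lemma vtx_edge l : square_edge l (square_vertex l).
Proof.
exists (-1); last by rewrite /square_vertex; ring.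
by rewrite lexx /= -subr_ge0 opprK addr_ge0.
Qed.

Lemma vtxS_edge l : square_edge l (square_vertex l.+1).
Proof.
exists 1; first by rewrite lexx andbT -subr_ge0 opprK addr_ge0.
transitivity (('i : C) ^+ l * ('i - 'i ^+ 2)); first by rewrite /square_vertex exprSr; ring.
by rewrite sqrCi; ring.
Qed.

Lemma edge_midconvex l : midconvex (square_edge l).
Proof.
move=> p q [x /andP[x1 x2] ->] [y /andP[y1 y2] ->]; exists (mid x y); last by field.
rewrite ler_pdivrMr // ler_pdivlMr // mulN1r mul1r -[2]/(1 + 1) opprD.
by rewrite !lerD.
Qed.

Lemma edge_square_bd l z : square_edge l z -> square_bd z. Proof. by exists l. Qed.

Lemma norm_i_exp l : `|('i : C) ^+ l| = 1.
Proof. by rewrite normrX normCi expr1n. Qed.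

Lemma real_pm1 (y : C) : -1 <= y <= 1 -> y \is Num.real.
Proof. by move=> /andP[_ h]; rewrite (ler_real h) rpred1. Qed.

Lemma Re_1iy (y : C) : -1 <= y <= 1 -> 'Re (1 + 'i * y) = 1.
Proof. by move=> /real_pm1 hy; rewrite Re_rect // rpred1. Qed.

Lemma square_bd_norm z : square_bd z -> 1 <= `|z| <= 2.
Proof.
move=> [l [y hy ->]]; rewrite normrM norm_i_exp mul1r; apply/andP; split.
  by rewrite -{1}(Re_1iy hy); exact: leif_Re_Creal.
apply: le_trans (ler_normD _ _) _; rewrite normrM normCi mul1r normr1 -[2]/(1 + 1) lerD2l.
by rewrite real_ler_norml // real_pm1.
Qed.

Lemma half_compl : 1 - 2^-1 = 2^-1 :> C. Proof. by field. Qed.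

Lemma square_bd_dist z a : square_bd z -> `|a| <= 2^-1 -> 2^-1 <= `|z - a|.
Proof.
move=> /square_bd_norm/andP[z1 _] a1; apply: le_trans (lerB_dist _ _).
apply: le_trans (lerB z1 a1).
by rewrite half_compl.
Qed.

Lemma normV2 : `|(2 : C)^-1| = 2^-1. Proof. by rewrite ger0_norm ?invr_ge0. Qed.

(** Along the square, dz / (z - a) has positive imaginary part because the
    square is traversed counterclockwise around a. This bound takes the place
    of the exact value of the integral of dz / (z - a). *)
Lemma Im_edge_ge l a z : square_edge l z -> `|a| <= 2^-1 ->
  8^-1 <= 'Im ((square_vertex l.+1 - square_vertex l) * (z - a)^-1).
Proof.
move=> [y hy ->] a1.
pose a' := a / 'i ^+ l; have il0 : ('i : C) ^+ l != 0 by rewrite expf_neq0 ?neq0Ci.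
have -> : (square_vertex l.+1 - square_vertex l) * ('i ^+ l * (1 + 'i * y) - a)^-1 =
    'i * (2 / (1 + 'i * y - a')).
  have -> : 'i ^+ l * (1 + 'i * y) - a = 'i ^+ l * (1 + 'i * y - a').
    by rewrite /a' mulrBr mulrCA divff // mulr1.
  have -> : square_vertex l.+1 - square_vertex l = 'i ^+ l * ('i * 2).
    transitivity (('i : C) ^+ l * ('i - 'i ^+ 2 - 1 + 'i)); first by rewrite /square_vertex exprSr; ring.
    by rewrite sqrCi; ring.
  by rewrite invfM mulrACA divff // mul1r mulrA.
rewrite ImMil Re_div.
have a1' : `|a'| <= 2^-1 by rewrite normrM normfV norm_i_exp invr1 mulr1.
have Ra : 'Re a' <= 2^-1.
  by apply: le_trans a1'; exact: leif_Re_Creal.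
have hz : 'Re (1 + 'i * y - a') = 1 - 'Re a' by rewrite raddfB /= Re_1iy.
have h1 : 2^-1 <= 1 - 'Re a'.
  apply: le_trans (lerB (lexx 1) Ra).
  by rewrite half_compl.
have -> : 'Re (2 : C) = 2 by apply/Creal_ReP; rewrite rpred_nat.
have -> : 'Im (2 : C) = 0 by apply/Creal_ImP; rewrite rpred_nat.
rewrite mul0r addr0 hz.
have n0 : 2^-1 <= `|1 + 'i * y - a'|.
  by apply: le_trans h1 _; rewrite -hz; exact: leif_Re_Creal.
have n1 : `|1 + 'i * y - a'| <= 2 + 2^-1.
  apply: le_trans (ler_normB _ _) _; apply: lerD => //.
  have := square_bd_norm (edge_square_bd (ex_intro2 _ _ y hy erefl : square_edge 0 ('i ^+ 0 * (1 + 'i * y)))).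
  by rewrite expr0 mul1r => /andP[].
have np : 0 < `|1 + 'i * y - a'| by apply: lt_le_trans n0; rewrite invr_gt0.
rewrite ler_pdivlMr ?exprn_gt0 //.
apply: (@le_trans _ _ (8^-1 * (2 + 2^-1) ^+ 2)).
  by rewrite ler_pM2l ?invr_gt0 // lerXn2r ?nnegrE.
apply: (@le_trans _ _ 1); last first.
  by rewrite mulrC -ler_pdivrMr // div1r.
have -> : (8^-1 * (2 + 2^-1) ^+ 2 : C) = 25 / 32 by field.
by rewrite ler_pdivrMr // mul1r ler_nat.
Qed.

Lemma norm_rot l (z : C) : `|z / 'i ^+ l| = `|z|.
Proof. by rewrite normrM normfV norm_i_exp invr1 mulr1. Qed.

Lemma vtxB l : square_vertex l.+1 - square_vertex l = 'i ^+ l * ('i * 2).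
Proof.
transitivity (('i : C) ^+ l * ('i - 'i ^+ 2 - 1 + 'i)); first by rewrite /square_vertex exprSr; ring.
by rewrite sqrCi; ring.
Qed.

Lemma vtxS l : square_vertex l.+1 = 'i * square_vertex l.
Proof. by rewrite /square_vertex exprS mulrA. Qed.

Lemma vtx4 : square_vertex 4 = square_vertex 0.
Proof. by rewrite /square_vertex (exprM 'i 2 2) sqrCi expr0 sqrrN expr1n. Qed.

Lemma square_sum_lin F G (c : C) k :
  square_sum (fun z => c * F z + G z) k = c * square_sum F k + square_sum G k.
Proof.
rewrite /square_sum mulr_sumr -big_split; apply: eq_bigr => l _; exact: midsum_lin.
Qed.

Lemma eq_square_sum F G k : (forall z, square_bd z -> F z = G z) -> square_sum F k = square_sum G k.
Proof.
move=> FG; apply: eq_bigr => l _; apply: (eq_midsum (K := square_edge l)).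
- exact: edge_midconvex.
- exact: vtx_edge.
- exact: vtxS_edge.
by move=> z /edge_square_bd; apply: FG.
Qed.

Lemma square_sum_le F M k : (forall z, square_bd z -> `|F z| <= M) -> `|square_sum F k| <= 8 * M.
Proof.
move=> FM; apply: le_trans (ler_norm_sum _ _ _) _.
have -> : 8 * M = \sum_(l < 4) (M * 2) by rewrite sumr_const card_ord; ring.
apply: ler_sum => l _.
have -> : M * 2 = M * `|square_vertex l.+1 - square_vertex l|.
  by rewrite vtxB !normrM norm_i_exp normCi !mul1r normr_nat.
apply: (midsum_le (K := square_edge l)).
- exact: edge_midconvex.
- exact: vtx_edge.
- exact: vtxS_edge.
by move=> z /edge_square_bd; apply: FM.
Qed.

Lemma square_sum_Im a k : `|a| <= 2^-1 -> 2^-1 <= 'Im (square_sum (fun z : C => (z - a)^-1) k).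
Proof.
move=> a1; rewrite raddf_sum /=.
have -> : 2^-1 = \sum_(l < 4) (8^-1 : C) by rewrite sumr_const card_ord; field.
apply: ler_sum => l _; apply: (midsum_Im_ge (K := square_edge l)).
- exact: edge_midconvex.
- exact: vtx_edge.
- exact: vtxS_edge.
by move=> z ze; apply: Im_edge_ge.
Qed.

Lemma midsum_rot k (p q : C) : midsum (fun z => z ^- 2) k ('i * p) ('i * q) =
  - 'i * midsum (fun z => z ^- 2) k p q.
Proof.
elim: k p q => [|k IH] p q /=.
  have -> : mid ('i * p) ('i * q) = 'i * mid p q by field.
  by rewrite exprMn sqrCi mulN1r invrN; ring.
have -> : mid ('i * p) ('i * q) = 'i * mid p q by field.
by rewrite !IH; ring.
Qed.

(** The substitution of i z for z maps the square to itself and multiplies dz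
    / z^2 by - i; the four edges thus contribute multiples of one sum by 1,
    -i, -1 and i. *)
Lemma square_sum_sqV k : square_sum (fun z : C => z ^- 2) k = 0.
Proof.
rewrite /square_sum !big_ord_recr big_ord0 /= add0r.
rewrite !(vtxS 3, vtxS 2, vtxS 1, vtxS 0) !midsum_rot.
set s := midsum _ _ _ _.
transitivity ((1 + 'i ^+ 2) * (1 - 'i) * s); first by ring.
by rewrite sqrCi subrr !mul0r.
Qed.

(** Provides the closed convex sets to which Goursat's lemma is applied: discs
    and half planes are sublevel sets of such functions. *)
Lemma lipschitz_seq_closed (phi : C -> C) (c : C) : c \is Num.real ->
  (forall z, phi z \is Num.real) -> (forall y z, phi z - phi y <= `|y - z|) ->
  seq_closed [set z | phi z <= c].
Proof.
move=> cr pr lip z hz /=; rewrite real_leNgt //; apply/negP => h.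
have [y yc yz] := hz (phi z - c) ltac:(by rewrite subr_gt0).
have := le_lt_trans (lip y z) yz.
by rewrite ltrD2l ltrN2 => /(le_lt_trans yc); rewrite ltxx.
Qed.

(** The difference quotient of f at a is differentiable away from a and
    bounded near a. Cutting the square into four triangles with common vertex
    a reduces the claim to [goursat_vertex]; the parts of these triangles away
    from a lie in a half plane that avoids a. *)
Lemma cauchy_quotient (f : C -> C) (a : C) : (forall z, `|z| <= 2 -> differentiable f z) ->
  `|a| <= 2^-1 -> null (square_sum (fun z => (f z - f a) * (z - a)^-1)).
Proof.
move=> df a1; set F := fun z => _.
have a2 : `|a| <= 2.
  by apply: le_trans a1 _; rewrite -div1r ler_pdivrMr // -natrM ler1n.
have dF z : `|z| <= 2 -> z != a -> differentiable F z.
  move=> z2 za; have -> : F = (f \- cst (f a)) * (fun y => (y - a)^-1).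
    by apply/funext.
  apply: differentiableM; first by apply: differentiableB => //; exact: df.
  apply: differentiableV; last by rewrite subr_eq0.
  by apply: differentiableB => //; exact: differentiable_cst.
(* At z = a the quotient is 0 / 0 = 0. *)
have [M [rho rho0 FM]] : exists M, exists2 rho, 0 < rho & forall z, `|z - a| <= rho -> `|F z| <= M.
  have [d d0 hd] := differentiable_approx (df a a2) (ltr01 : (0 : C) < 1).
  exists (1 + `|'d f a 1|), (d / 2) => [|z zd]; first by rewrite divr_gt0.
  have [->|za] := eqVneq z a; first by rewrite /F !subrr mul0r normr0 addr_ge0.
  rewrite /F normrM normfV ler_pdivrMr ?normr_gt0 ?subr_eq0 //.
  have zd' : `|z - a| < d by apply: le_lt_trans zd _; rewrite ltr_pdivrMr // ltr_pMr // ltr1n.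
  have := hd _ zd'; rewrite subrK mul1r => h.
  have hA : 'd f a (z - a) = (z - a) * 'd f a 1.
    by apply: diff_scalar; exact: df.
  rewrite mulrDl mul1r [_ * `|z - a|]mulrC -normrM -hA.
  by rewrite -lerBlDr; apply: le_trans (lerB_dist _ _) h.
have tri l : null (fun k => trisum F k a (square_vertex l) (square_vertex l.+1)).
  have il0 : ('i : C) ^+ l != 0 by rewrite expf_neq0 ?neq0Ci.
  pose ph z := 'Re ((z - a) / 'i ^+ l).
  have phr z : ph z \is Num.real by exact: Creal_Re.
  pose L : set C := [set z | `|z - 0| <= 2 /\ 0 < ph z].
  have phm x y : ph (mid x y) = mid (ph x) (ph y).
    rewrite /ph; have -> : (mid x y - a) / 'i ^+ l = 2^-1 * ((x - a) / 'i ^+ l + (y - a) / 'i ^+ l).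
      by field.
    by rewrite ReMl ?rpredV ?rpred_nat // raddfD /= mulrC.
  have lip y z : - ph z - - ph y <= `|y - z|.
    have -> : - ph z - - ph y = 'Re ((y - z) / 'i ^+ l).
      by rewrite /ph opprK addrC -raddfB /= -mulrBl; congr ('Re (_ * _)); ring.
    rewrite -(norm_rot l (y - z)).
    exact: leif_Re_Creal.
  have Lv x : square_edge l x -> L x.
    move=> xe; split; first by rewrite subr0; have /square_bd_norm/andP[] := edge_square_bd xe.
    case: xe => y hy ->; rewrite /ph mulrBl [_ * (1 + _)]mulrC mulfK // raddfB /= Re_1iy //.
    rewrite subr_gt0; apply: (@le_lt_trans _ _ 2^-1); last by rewrite invf_lt1 // ltr1n.
    apply: le_trans a1; rewrite -(norm_rot l a).
    exact: leif_Re_Creal.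
  apply: (goursat_vertex (L := L) (M := M) (rho := rho)) => //.
  - move=> x y z [x2 x0] [y2 y0] [z2 z0].
    pose c := ((ph x)^-1 + (ph y)^-1 + (ph z)^-1)^-1.
    have s0 : 0 < (ph x)^-1 + (ph y)^-1 + (ph z)^-1 by rewrite !addr_gt0 ?invr_gt0.
    have c0 : 0 < c by rewrite invr_gt0.
    pose K : set C := [set z | `|z - 0| <= 2] `&` [set z | - ph z <= - c].
    apply: (@goursat K).
    + move=> u v [u2 /=]; rewrite lerN2 => uc [v2 /=]; rewrite lerN2 => vc.
      split; first exact: ball_midconvex.
      rewrite /= lerN2 phm (splitr c) mulrDl; apply: lerD; rewrite ler_pM2r ?invr_gt0 //.
    + move=> u hu; split.
        apply: (@lipschitz_seq_closed (fun z => `|z - 0|)) => //.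
          by move=> v w; rewrite !subr0 distrC lerB_dist.
        by move=> e /hu[v [? ?] ?]; exists v.
      apply: (@lipschitz_seq_closed (fun z => - ph z)) => //.
      + by rewrite rpredN ger0_real // ltW.
      + by move=> v; rewrite rpredN.
      by move=> e /hu[v [? ?] ?]; exists v.
    + move=> u [u2 /=]; rewrite lerN2 => uc; apply: dF; first by rewrite -[u]subr0.
      apply/eqP => ua; move: uc; rewrite ua /ph subrr mul0r raddf0 => /(lt_le_trans c0).
      by rewrite ltxx.
    + split => //=; rewrite lerN2 invf_ple ?posrE //.
      by rewrite -addrA lerDl addr_ge0 ?invr_ge0 ?ltW.
    + split => //=; rewrite lerN2 invf_ple ?posrE //.
      by rewrite addrAC lerDr addr_ge0 ?invr_ge0 ?ltW.
    + split => //=; rewrite lerN2 invf_ple ?posrE //.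
      by rewrite lerDr addr_ge0 ?invr_ge0 ?ltW.
  - move=> x y [x2 x0] [y2 y0]; split; first exact: ball_midconvex.
    by rewrite phm divr_gt0 // addr_gt0.
  - move=> x [x2 x0]; split; first by apply: ball_midconvex => //=; rewrite subr0.
    by rewrite phm /ph subrr mul0r raddf0 add0r divr_gt0.
  - by apply: Lv; exact: vtx_edge.
  - by apply: Lv; exact: vtxS_edge.
apply: nullE (nullD (nullD (tri 0%N) (tri 1%N)) (nullD (tri 2%N) (tri 3%N))) => k.
rewrite /square_sum !big_ord_recr big_ord0 /= /trisum vtx4.
rewrite (midsumC F k a (square_vertex 1)) (midsumC F k a (square_vertex 2)) (midsumC F k a (square_vertex 3)) (midsumC F k a (square_vertex 0)).
by ring.
Qed.

Definition near_along (U : set_system nat) (s : nat -> C) (l : C) :=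
  forall e, 0 < e -> U [set k | `|s k - l| < e].

(** Limits along a fixed ultrafilter exist for all bounded sequences at once
    and depend linearly on the sequence. Taking them makes a functional out of
    the sums over the square without having to prove that these sums converge. *)
Definition has_ultralimits := exists U : set_system nat,
  [/\ ProperFilter U, \oo `<=` U &
      forall (s : nat -> C) (M : C), (forall k, `|s k| <= M) -> exists l, near_along U s l].

Hypothesis C_ultra : has_ultralimits.

(** The functional J stands for the contour integral over the square. *)
Lemma cauchy_functional : exists J : (C -> C) -> C,
  [/\ forall (c : C) (phi psi : C -> C) (M N : C), (forall z, square_bd z -> `|phi z| <= M) ->
        (forall z, square_bd z -> `|psi z| <= N) ->
        J (fun z => c * phi z + psi z) = c * J phi + J psi,
      forall (phi : C -> C) (M : C), (forall z, square_bd z -> `|phi z| <= M) -> `|J phi| <= 8 * M,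
      forall phi psi : C -> C, (forall z, square_bd z -> phi z = psi z) -> J phi = J psi,
      forall (phi : C -> C) (l : C), (forall e : C, 0 < e -> exists n, forall k, (n <= k)%N ->
         `|square_sum phi k - l| < e) -> J phi = l &
      forall a : C, `|a| <= 2^-1 -> 2^-1 <= `|J (fun z => (z - a)^-1)| ].
Proof.
have [U [PU ooU hU]] := C_ultra.
have FU : Filter U by typeclasses eauto.
have U1 P : U P -> exists k, P k by apply: (@filter_ex _ U PU).
pose J phi : C := xget 0 [set l | near_along U (square_sum phi) l].
have near_uniq s l l' : near_along U s l -> near_along U s l' -> l = l'.
  move=> h h'; apply/eqP; rewrite -subr_eq0 -normr_eq0 eq_le normr_ge0 andbT.
  rewrite real_leNgt ?normr_real //; apply/negP => d0.
  have d2 : 0 < `|l - l'| / 2 by rewrite divr_gt0.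
  have [k [/= k1 k2]] := U1 _ (@filterI _ U FU _ _ (h _ d2) (h' _ d2)).
  suff : `|l - l'| < `|l - l'| by rewrite ltxx.
  apply: le_lt_trans (ler_distD (s k) _ _) _.
  by rewrite [X in _ < X]splitr distrC ltrD.
have Jl phi l : near_along U (square_sum phi) l -> J phi = l.
  move=> h; have h1 := h; apply: near_uniq h1.
  by apply: (@xgetPex _ 0 [set l | near_along U (square_sum phi) l]); exists l.
have Jn phi M : (forall z, square_bd z -> `|phi z| <= M) -> near_along U (square_sum phi) (J phi).
  move=> pM; have [l hl] := hU (square_sum phi) (8 * M) (fun k => square_sum_le k pM).
  by apply: (@xgetPex _ 0 [set l | near_along U (square_sum phi) l]); exists l.
exists J; split.
- move=> c phi psi M N pM pN; apply: Jl => e e0.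
  have c0 : 0 < 1 + `|c| by rewrite ltr_wpDr.
  have e2 : 0 < e / (1 + `|c|) by rewrite divr_gt0.
  have ec : 0 < e / 2 / (1 + `|c|) by rewrite !divr_gt0.
  have e20 : 0 < e / 2 by rewrite divr_gt0.
  apply: (@filterS _ U FU _ _ _ (@filterI _ U FU _ _ (Jn _ _ pM _ ec) (Jn _ _ pN _ e20))) => k [/= k1 k2].
  rewrite square_sum_lin.
  have -> : c * square_sum phi k + square_sum psi k - (c * J phi + J psi) =
     c * (square_sum phi k - J phi) + (square_sum psi k - J psi) by ring.
  apply: le_lt_trans (ler_normD _ _) _; rewrite [X in _ < X]splitr ler_ltD //.
  rewrite normrM; apply: (@le_trans _ _ ((1 + `|c|) * (e / 2 / (1 + `|c|)))).
    by apply: ler_pM => //; [rewrite lerDr | exact: ltW].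
  by rewrite mulrC divfK // gt_eqF.
- move=> phi M pM; rewrite real_leNgt ?normr_real //; last first.
    by apply: ger0_real; apply: le_trans (square_sum_le 0 pM).
  apply/negP => h.
  have [k /= hk] := U1 _ (Jn _ _ pM (`|J phi| - 8 * M) ltac:(by rewrite subr_gt0)).
  have := square_sum_le k pM; suff : 8 * M < `|square_sum phi k|.
    by move=> /lt_le_trans h1 /h1; rewrite ltxx.
  have := le_lt_trans (lerB_dist _ _) (_ : `|J phi - square_sum phi k| < `|J phi| - 8 * M).
  by rewrite distrC => /(_ hk); rewrite ltrD2l ltrN2.
- move=> phi psi pp; rewrite /J; have -> // : square_sum phi = square_sum psi.
  by apply/funext => k; apply: eq_square_sum.
- move=> phi l h; apply: Jl => e e0; apply: ooU; have [n hn] := h e e0.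
  by exists n => // k /= nk; apply: hn.
- move=> a a1.
  have pM z : square_bd z -> `|(z - a)^-1| <= 2.
    move=> /square_bd_dist/(_ a1) h; rewrite normfV invf_ple ?posrE //.
    by apply: lt_le_trans h; rewrite invr_gt0.
  have h := Jn _ _ pM; rewrite real_leNgt ?normr_real ?rpredV ?rpred_nat //; apply/negP => hlt.
  have [k /= hk] := U1 _ (h (2^-1 - `|J (fun z => (z - a)^-1)|) ltac:(by rewrite subr_gt0)).
  suff : 2^-1 < (2^-1 : C) by rewrite ltxx.
  apply: le_lt_trans (square_sum_Im k a1) _.
  apply: (@le_lt_trans _ _ `|square_sum (fun z => (z - a)^-1) k|).
    rewrite -[square_sum _ _]opprK raddfN -ReMil mulrN.
    apply: le_trans (leif_Re_Creal _) _; by rewrite ?opprK !normrN normrM normCi mul1r.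
  have := le_lt_trans (lerB_dist _ _) hk.
  by rewrite ltrBlDr subrK.
Qed.

Lemma square_bd1 : square_bd 1.
Proof.
exists 0%N, 0; last by rewrite mulr0 addr0 mulr1 expr0.
by rewrite ler01 andbT oppr_le0 ler01.
Qed.

(** Cauchy's formula w(a) f(a) = J (f / (z - a)), expanded in powers of a.
    Here w(a) = J (1 / (z - a)) stands for the winding factor 2 pi i; it is
    bounded away from 0, and constant up to O(a^2) because J (1 / z^2) = 0 by
    symmetry. The constant 16 is the length 8 of the square times the bound 2
    for 1 / (z - a). *)
Lemma taylor_functional : exists w : C -> C,
  [/\ forall a, `|a| <= 2^-1 -> 2^-1 <= `|w a|,
      forall a, `|a| <= 2^-1 -> `|w a - w 0| <= 16 * `|a| ^+ 2 &
      forall (f : C -> C) (M : C), (forall z : C, `|z| <= 2 -> differentiable f z) ->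
        (forall z, square_bd z -> `|f z| <= M) ->
        exists c : nat -> C, forall n a, `|a| <= 2^-1 ->
          `|w a * f a - \sum_(j < n) c j * a ^+ j| <= 16 * M * `|a| ^+ n].
Proof.
have [J [Jlin Jle Jext Jlim Jge]] := cauchy_functional.
have expand (f : C -> C) (M a : C) n : (forall z, square_bd z -> `|f z| <= M) -> `|a| <= 2^-1 ->
    `|J (fun z => f z * (z - a)^-1) - \sum_(j < n) J (fun z => f z * z ^- j.+1) * a ^+ j|
    <= 16 * M * `|a| ^+ n.
  move=> fM a1; pose phi n z := f z * (z ^+ n * (z - a))^-1.
  have M0 : 0 <= M by apply: le_trans (fM _ square_bd1).
  have zge k z : square_bd z -> `|z ^- k| <= 1.
    move=> /square_bd_norm/andP[z1 _]; rewrite normfV normrX invf_le1.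
      by rewrite exprn_ege1.
    by rewrite exprn_gt0 // (lt_le_trans ltr01).
  have pM k z : square_bd z -> `|phi k z| <= M * 2.
    move=> zb; rewrite /phi normrM; apply: ler_pM => //; first exact: fM.
    rewrite invfM normrM -[X in _ <= X]mul1r; apply: ler_pM => //; first exact: zge.
    rewrite normfV invf_ple ?posrE //; first exact: square_bd_dist.
    by apply: lt_le_trans (square_bd_dist zb a1); rewrite invr_gt0.
  have fzM k z : square_bd z -> `|f z * z ^- k| <= M.
    by move=> zb; rewrite normrM -[X in _ <= X]mulr1; apply: ler_pM => //; [exact: fM|exact: zge].
  have rec k : J (phi k) = a * J (phi k.+1) + J (fun z => f z * z ^- k.+1).
    rewrite -(Jlin a _ _ _ _ (pM k.+1) (fzM k.+1)); apply: Jext => z zb.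
    rewrite /phi exprSr; field.
    have /andP[z1 _] := square_bd_norm zb.
    have zn0 : z != 0 by rewrite -normr_gt0 (lt_le_trans ltr01).
    by rewrite zn0 expf_neq0 //= -normr_gt0 (lt_le_trans _ (square_bd_dist zb a1)) // invr_gt0.
  have -> : J (fun z => f z * (z - a)^-1) = J (phi 0%N).
    by apply: Jext => z zb; rewrite /phi expr0 mul1r.
  have -> : J (phi 0%N) - \sum_(j < n) J (fun z => f z * z ^- j.+1) * a ^+ j =
     a ^+ n * J (phi n).
    elim: n => [|k IH]; first by rewrite big_ord0 subr0 expr0 mul1r.
    by rewrite big_ord_recr /= opprD addrA IH rec exprSr; ring.
  rewrite normrM normrX mulrC ler_wpM2r ?exprn_ge0 //.
  by apply: le_trans (Jle _ _ (pM n)) _; have -> : 8 * (M * 2) = 16 * M by ring.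
have one z : square_bd z -> `|(fun=> 1 : C) z| <= 1 by rewrite normr1.
pose w a := J (fun z => (z - a)^-1); exists w; split.
- exact: Jge.
- move=> a a1; have := expand (fun=> 1) 1 a 2%N one a1.
  rewrite mulr1 !big_ord_recr big_ord0 /= add0r expr0 mulr1.
  have -> : J (fun z => 1 * z ^- 2) = 0.
    rewrite (Jext _ (fun z => z ^- 2)); last by move=> z _; rewrite mul1r.
    by apply: Jlim => e e0; exists 0%N => k _; rewrite square_sum_sqV subr0 normr0.
  have -> : J (fun z => 1 * (z - a)^-1) = w a by apply: Jext => z _; rewrite mul1r.
  have -> : J (fun z => 1 * z ^- 1) = w 0.
    by apply: Jext => z _; rewrite mul1r subr0 expr1.
  by rewrite mul0r addr0.
move=> f M df fM; exists (fun j => J (fun z => f z * z ^- j.+1)) => n a a1.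
suff <- : J (fun z => f z * (z - a)^-1) = w a * f a by apply: expand.
have M0 : 0 <= M by apply: le_trans (fM _ square_bd1).
have vM z : square_bd z -> `|(z - a)^-1| <= 2.
  move=> zb; rewrite normfV invf_ple ?posrE //; first exact: square_bd_dist.
  by apply: lt_le_trans (square_bd_dist zb a1); rewrite invr_gt0.
have FM z : square_bd z -> `|(f z - f a) * (z - a)^-1| <= (M + `|f a|) * 2.
  move=> zb; rewrite normrM; apply: ler_pM => //; last exact: vM.
  by apply: le_trans (ler_normB _ _) _; rewrite lerD2r fM.
have h0 : J (fun z => (f z - f a) * (z - a)^-1) = 0.
  apply: Jlim => e e0.
  have /nullP/(_ e e0)[k hk] := cauchy_quotient df a1.
  by exists k => i /hk; rewrite subr0.
rewrite (Jext _ (fun z => f a * (z - a)^-1 + (f z - f a) * (z - a)^-1)).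
  by rewrite (Jlin _ _ _ _ _ vM FM) h0 addr0 mulrC.
by move=> z _; rewrite -mulrDl [f a + _]addrC subrK.
Qed.

Lemma half_le (u x y : C) : 0 <= x -> 2^-1 <= u -> u * x <= y -> x <= 2 * y.
Proof.
move=> x0 u2 uxy; apply: (@le_trans _ _ (2 * (u * x))); last by rewrite ler_pM2l.
by rewrite mulrA ler_peMl // -ler_pdivrMl // mulr1.
Qed.

Lemma norm_value_le (f : C -> C) (M : C) : (forall z : C, `|z| <= 2 -> differentiable f z) ->
  (forall z, square_bd z -> `|f z| <= M) -> forall a, `|a| <= 2^-1 -> `|f a| <= 32 * M.
Proof.
move=> df fM a a1; have [w [w1 _ /(_ f M df fM)[c hc]]] := taylor_functional.
have := hc 0%N a a1; rewrite big_ord0 subr0 expr0 mulr1 normrM => h.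
have -> : 32 * M = 2 * (16 * M) by rewrite mulrA -natrM.
exact: half_le (w1 _ a1) h.
Qed.

(** Zeros that cluster at 0 force all the coefficients c_j to vanish, one
    after the other, and then the remainders of order n show that f vanishes
    on the disc of radius 1/2. *)
Lemma zeros_cluster (f : C -> C) (M : C) :
  (forall z : C, `|z| <= 2 -> differentiable f z) ->
  (forall z, square_bd z -> `|f z| <= M) ->
  (forall d, 0 < d -> exists z, [/\ z != 0, `|z| < d & f z = 0]) ->
  forall a, `|a| <= 2^-1 -> f a = 0.
Proof.
move=> df fM f0 a a1; have [w [w1 _ /(_ f M df fM)[c hc]]] := taylor_functional.
have M0 : 0 <= M by apply: le_trans (fM _ square_bd1).
have c0 n : c n = 0.
  elim/ltn_ind: n => n IH; apply/eqP; rewrite -normr_eq0 eq_le normr_ge0 andbT.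
  rewrite real_leNgt ?normr_real //; apply/negP => cn0.
(* A zero z of modulus below d contradicts the expansion to order n + 1. *)
  pose d := `|c n| / (16 * M + 1).
  have M1 : 0 < 16 * M + 1 by rewrite ltr_wpDl // mulr_ge0.
  have [|z [z0 zd fz]] := f0 ((d^-1 + 2)^-1).
    by rewrite invr_gt0 addr_gt0 // invr_gt0 divr_gt0.
  have d0 : 0 < d by rewrite divr_gt0.
  have zd1 : `|z| < d.
    apply: lt_trans zd _; rewrite invf_plt ?posrE ?addr_gt0 ?invr_gt0 //.
    by rewrite ltrDl.
  have z2 : `|z| <= 2^-1.
    apply/ltW; apply: lt_trans zd _; rewrite ltf_pV2 ?posrE ?addr_gt0 ?invr_gt0 //.
    by rewrite ltrDr invr_gt0.
  have := hc n.+1 z z2; rewrite fz mulr0 sub0r normrN big_ord_recr /=.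
  rewrite big1 ?add0r; last by move=> i _; rewrite IH ?mul0r.
  rewrite normrM normrX exprSr mulrA mulrAC ler_pM2r ?exprn_gt0 ?normr_gt0 // => h.
  suff : `|c n| < `|c n| by rewrite ltxx.
  apply: le_lt_trans h _; apply: (@le_lt_trans _ _ ((16 * M + 1) * `|z|)).
    by rewrite ler_wpM2r // lerDl.
  by rewrite mulrC -ltr_pdivlMr.
apply/eqP; rewrite -normr_eq0 eq_le normr_ge0 andbT.
rewrite real_leNgt ?normr_real //; apply/negP => fa0.
have f20 : 0 < `|f a| / 2 by rewrite divr_gt0.
have M16 : 0 <= 16 * M by rewrite mulr_ge0.
have [n hn] := half_pow_small M16 f20.
have := hc n a a1; rewrite big1 ?subr0; last by move=> i _; rewrite c0 mul0r.
move=> h; suff : `|f a| / 2 < `|f a| / 2 by rewrite ltxx.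
apply: le_lt_trans hn; apply: le_trans (_ : `|w a * f a| <= _).
  by rewrite normrM mulrC ler_wpM2r // w1.
apply: le_trans h _; rewrite ler_wpM2l // -exprVn lerXn2r ?nnegrE ?invr_ge0 //.
Qed.

(** Second order Taylor estimate with a constant that depends on neither the
    function nor its bound, so that it survives passage to limits of
    functions. *)
Lemma taylor2 : exists2 K : C, 0 <= K & forall (f : C -> C) (M : C),
  (forall z : C, `|z| <= 2 -> differentiable f z) ->
  (forall z, square_bd z -> `|f z| <= M) ->
  `|'d f 0 1| <= K * M /\
  forall a, `|a| <= 2^-1 -> `|f a - f 0 - a * 'd f 0 1| <= K * M * `|a| ^+ 2.
Proof.
have [k k0 hk] : exists2 k : C, 0 <= k & k = 16 + 16 * 32.
  by exists (16 + 16 * 32) => //; rewrite addr_ge0 // mulr_ge0.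
exists (2 * k + 128) => [|f M df fM]; first by rewrite addr_ge0 // mulr_ge0.
have [w [w1 w2 /(_ f M df fM)[c hc]]] := taylor_functional.
have M0 : 0 <= M by apply: le_trans (fM _ square_bd1).
have z1 : `|0 : C| <= 2^-1 by rewrite normr0 invr_ge0.
have c00 : c 0%N = w 0 * f 0.
  have := hc 1%N 0 z1; rewrite big_ord1 expr0 mulr1 normr0 expr1 mulr0 normr_le0.
  by rewrite subr_eq0 => /eqP ->.
have w00 : w 0 != 0 by rewrite -normr_gt0 (lt_le_trans _ (w1 _ z1)) // invr_gt0.
pose g := c 1%N / w 0.
have hg a : `|a| <= 2^-1 -> `|f a - f 0 - a * g| <= (2 * k) * M * `|a| ^+ 2.
  move=> a1; have h2 := hc 2%N a a1.
  have e : w 0 * (f a - f 0 - a * g) =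
     (w a * f a - \sum_(j < 2) c j * a ^+ j) - (w a - w 0) * f a.
    by rewrite !big_ord_recr big_ord0 /= c00 /g; field.
  have : `|w 0 * (f a - f 0 - a * g)| <= k * M * `|a| ^+ 2.
    rewrite e hk; apply: le_trans (ler_normB _ _) _.
    have -> : (16 + 16 * 32) * M * `|a| ^+ 2 = 16 * M * `|a| ^+ 2 + 16 * `|a| ^+ 2 * (32 * M) by ring.
    apply: lerD => //; rewrite normrM; apply: ler_pM => //; first exact: w2.
    exact: norm_value_le.
  rewrite normrM => h; have -> : (2 * k) * M * `|a| ^+ 2 = 2 * (k * M * `|a| ^+ 2) by ring.
  exact: half_le (w1 _ z1) h.
have gD : g = 'd f 0 1.
  apply/eqP; rewrite -subr_eq0 -normr_eq0 eq_le normr_ge0 andbT.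
  rewrite real_leNgt ?normr_real //; apply/negP => gd0; set D := 'd f 0 1 in gd0 *.
  set e := `|g - D| in gd0.
  have e40 : 0 < e / 4 by rewrite divr_gt0.
  have [|d d0 hd] := differentiable_approx (df 0 _) e40; first by rewrite normr0.
  have M1 : 0 < (2 * k) * M + 1 by rewrite ltr_wpDl // !mulr_ge0.
  pose a := (d^-1 * 2 + 2 + (e / 4 / ((2 * k) * M + 1))^-1)^-1.
  have x1 : 0 < d^-1 * 2 by rewrite mulr_gt0 // invr_gt0.
  have x3 : 0 < (e / 4 / ((2 * k) * M + 1))^-1 by rewrite invr_gt0 divr_gt0.
  have a0 : 0 < a by rewrite invr_gt0 !addr_gt0.
  have na : `|a| = a by rewrite gtr0_norm.
  have ad : `|a| < d.
    rewrite na invf_plt ?posrE ?addr_gt0 //.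
    rewrite -addrA ltr_wpDr //; first by rewrite addr_ge0 // ltW.
    by rewrite ltr_pMr ?invr_gt0 // ltr1n.
  have a2 : `|a| <= 2^-1.
    rewrite na lef_pV2 ?posrE ?addr_gt0 //.
    by rewrite addrAC lerDr addr_ge0 // ltW.
  have a3 : ((2 * k) * M + 1) * a <= e / 4.
    rewrite mulrC -ler_pdivlMr // invf_ple ?posrE ?addr_gt0 ?divr_gt0 //.
    by rewrite lerDr addr_ge0 // ltW.
  have h1 := hg a a2; have := hd a ad; rewrite addr0.
  rewrite (diff_scalar a (df 0 _)) ?normr0 // -/D => h2.
  have : e * a <= e / 4 * a + e / 4 * a.
    rewrite -{1}na /e -normrM.
    have -> : (g - D) * a = (f a - f 0 - a * D) - (f a - f 0 - a * g) by ring.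
    apply: le_trans (ler_normB _ _) _; rewrite na in h2 h1; apply: lerD => //.
    apply: le_trans h1 _; rewrite expr2 mulrA ler_pM2r //; apply: le_trans a3.
    by rewrite ler_pM2r // lerDl.
  have -> : e / 4 * a + e / 4 * a = e * a / 2 by field.
  by rewrite ler_pdivlMr // ger_pMr ?mulr_gt0 // lern1.
rewrite -gD; split; last first.
  move=> a a1; apply: le_trans (hg a a1) _; rewrite ler_wpM2r ?exprn_ge0 //.
  by rewrite ler_wpM2r // lerDl.
have h2 : `|2^-1 : C| <= 2^-1 by rewrite normV2.
have := hg 2^-1 h2; rewrite normV2 => h.
have : `|2^-1 * g| <= (2 * k) * M * 2^-1 ^+ 2 + 32 * M + 32 * M.
  have -> : 2^-1 * g = - (f 2^-1 - f 0 - 2^-1 * g) + f 2^-1 - f 0 by ring.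
  apply: le_trans (ler_normB _ _) _; apply: lerD; last exact: norm_value_le.
  apply: le_trans (ler_normD _ _) _; apply: lerD; last exact: norm_value_le.
  by rewrite normrN.
have -> : 2 * k * M * 2^-1 ^+ 2 + 32 * M + 32 * M = (k + 128) * M / 2 by field.
rewrite normrM normV2 mulrC ler_pM2r ?invr_gt0 // => /le_trans; apply.
by rewrite ler_wpM2r // lerD2r ler_peMl // ler1n.
Qed.

Local Notation line f u v := (fun t : C => f (u + t *: v)).

Lemma line_differentiable (V W : normedModType C) (f : V -> W) u v t :
  differentiable f (u + t *: v) -> differentiable (line f u v) t.
Proof.
move=> df; have h : differentiable (fun t : C => u + t *: v) t.
  apply: (@differentiableD _ _ _ (cst u) (fun t : C => t *: v)); first exact: differentiable_cst.
  by apply: differentiableZl.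
exact: (differentiable_comp h df).
Qed.

Lemma diff_line (V W : normedModType C) (f : V -> W) (u v : V) : differentiable f u ->
  'd (fun t : C => f (u + t *: v)) (0 : C) 1 = 'd f u v.
Proof.
move=> df.
have df' : differentiable (fun t : C => f (u + t *: v)) (0 : C).
  by apply: line_differentiable; rewrite scale0r addr0.
rewrite -(deriveE _ df) -(deriveE _ df') /derive.
set F := (F in lim (F @ _) = _); set G := (G in _ = lim (G @ _)).
suff -> : F = G by [].
apply/funext => h; rewrite /F /G /=; rewrite scale0r !addr0 [h *: 1]mulr1.
by rewrite [h *: v + u]addrC.
Qed.

(** The estimate of [taylor2] along complex lines, in several variables. The
    direction d is rescaled to length r / 4, so that the square of half side 1
    stays in the ball of radius r. *)
Lemma taylor2_ball : exists2 K : C, 0 <= K & forall (V : normedModType C) (q : V -> C) (u : V)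
  (r B : C), 0 < r -> (forall w, differentiable q w) ->
  (forall w, `|w - u| < r -> `|q w| <= B) ->
  forall d, `|'d q u d| <= K * B * (`|d| / r) /\
    (`|d| <= r / 8 -> `|q (u + d) - q u - 'd q u d| <= K * B * (`|d| / r) ^+ 2).
Proof.
have [k k0 hk] := taylor2.
exists (16 * k) => [|V q u r B r0 dq qB d]; first by rewrite mulr_ge0.
have B0 : 0 <= B by apply: le_trans (qB u _); rewrite ?subrr ?normr0.
have [->|dn0] := eqVneq d 0.
  by rewrite linear0 addr0 !subrr !normr0 mul0r expr0n !mulr0.
have nd0 : 0 < `|d| by rewrite normr_gt0.
pose a := 4 * (`|d| / r); pose v := a^-1 *: d.
have a0 : 0 < a by rewrite mulr_gt0 // divr_gt0.
have na : `|a| = a by rewrite gtr0_norm.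
have av : a *: v = d by rewrite /v scalerA divff ?scale1r // gt_eqF.
have nv : `|v| = r / 4.
  rewrite /v normrZ ger0_norm ?invr_ge0 ?ltW // /a; field.
  by rewrite !gt_eqF.
pose f := fun t : C => q (u + t *: v).
have df t : `|t| <= 2 -> differentiable f t by move=> _; apply: line_differentiable; exact: dq.
have fB z : square_bd z -> `|f z| <= B.
  move=> /square_bd_norm/andP[_ z2]; apply: qB; rewrite [u + _]addrC addrK normrZ nv.
  apply: (@le_lt_trans _ _ (2 * (r / 4))); first by rewrite ler_wpM2r // divr_ge0 // ltW.
  by rewrite mulrCA gtr_pMr // ltr_pdivrMr // mul1r ltr_nat.
have [h1 h2] := hk f B df fB.
have hD : 'd f 0 1 = 'd q u v by exact: diff_line.
have hd : 'd q u d = a * 'd q u v by rewrite -{1}av linearZ.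
have kB : 0 <= k * B by rewrite mulr_ge0.
split.
  rewrite hd normrM na -hD; apply: (@le_trans _ _ (a * (k * B))).
    by rewrite ler_pM2l.
  have -> : 16 * k * B * (`|d| / r) = a * (k * B) * 4 by rewrite /a; ring.
  by rewrite ler_peMr ?ler1n // mulr_ge0 // ltW.
move=> dr; have a2 : `|a| <= 2^-1.
  rewrite na /a mulrA ler_pdivrMr //; apply: (@le_trans _ _ (4 * (r / 8))).
    by rewrite ler_pM2l.
  have -> : 4 * (r / 8) = 2^-1 * r by field.
  by [].
have := h2 a a2; rewrite hD -hd /f av scale0r addr0 na => h.
apply: le_trans h _; have -> : 16 * k * B * (`|d| / r) ^+ 2 = k * B * a ^+ 2 by rewrite /a; ring.
by [].
Qed.

(** * Division by a holomorphic function in a Banach space of holomorphic functions *)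

Hypothesis square_bd_compact : compact square_bd.

Variables (V Y : normedModType C) (E : set V) (e : V -> Y -> C).
Hypothesis Y_complete : seq_complete Y.
Hypothesis openE : open E.
Hypothesis e_linear : forall u, E u -> forall (c : C) h k, e u (c *: h + k) = c * e u h + e u k.
Hypothesis e_bounded : forall u, E u -> exists2 M : C, 0 <= M & forall h, `|e u h| <= M * `|h|.
Hypothesis e_diff : forall h u, E u -> differentiable (fun w => e w h) u.

Lemma ball_in_open u : E u -> exists2 r : C, 0 < r & forall w, `|w - u| < r -> E w.
Proof.
move=> Eu; have /nbhs_normP[r /= r0 hr] : nbhs u E by exact: open_nbhs_nbhs.
by exists r => // w wr; apply: hr => /=; rewrite distrC.
Qed.

Lemma evaluation0 u : E u -> e u 0 = 0.
Proof.
move=> Eu; have := e_linear Eu 1 0 0; rewrite scaler0 addr0 mul1r.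
by move=> /(congr1 (fun x => x - e u 0)); rewrite addrK subrr.
Qed.

Lemma evaluationB u h k : E u -> e u (h - k) = e u h - e u k.
Proof.
by move=> Eu; have := e_linear Eu (-1) k h; rewrite scaleN1r addrC mulN1r => ->; rewrite addrC.
Qed.

Lemma evaluationZ u c h : E u -> e u (c *: h) = c * e u h.
Proof. by move=> Eu; have := e_linear Eu c h 0; rewrite evaluation0 // !addr0. Qed.

(** Uniform boundedness of the evaluations at points near u. Otherwise points
    w_n tending to u and nested balls in Y could be chosen such that the
    evaluation at w_n is at least 2^n on the n-th ball; an element common to
    all balls would be unbounded near u, although it is continuous there. *)
Lemma locally_bounded_evaluation u : E u -> exists2 M : C, 0 <= M & exists2 r : C, 0 < r &
  forall w, `|w - u| < r -> E w /\ forall h, `|e w h| <= M * `|h|.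
Proof.
move=> Eu; have [r0 r00 hE] := ball_in_open Eu.
apply: contrapT => nb.
have frequently_large (r M : C) : 0 < r -> 0 <= M -> exists w h, [/\ `|w - u| < r, E w & M * `|h| < `|e w h|].
  move=> rp Mp; apply: contrapT => nw; apply: nb; exists M => //.
  have [r1 [r1p r1r r1r0]] := min_pos rp r00.
  exists r1 => // w wr; have Ew : E w by apply: hE; apply: lt_le_trans wr _.
  split=> // h; rewrite real_leNgt ?normr_real ?ger0_real ?mulr_ge0 //.
  by apply/negP => hh; apply: nw; exists w, h; split => //; apply: lt_le_trans wr _.
pose Inv n (s : Y * C) := 0 < s.2 /\
  ((0 < n)%N -> exists w, [/\ `|w - u| < r0 / 2 ^+ n, E w &
     forall y, `|y - s.1| <= s.2 -> 2 ^+ n <= `|e w y|]).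
have [] := @nested_balls Y (Y * C)%type (fun s => s.1) (fun s => s.2) Inv (0, 1) Y_complete.
- by split.
- exact: ler01.
- move=> n [x rho] [/= rp _] _.
  set N : C := 2 ^+ n.+1 + 1.
  have N0 : 0 < N by rewrite addr_gt0 // exprn_gt0.
  have [w [h [wr Ew hw]]] := frequently_large (r0 / 2 ^+ n.+1) (N * 2 / rho)
    ltac:(by rewrite divr_gt0 ?exprn_gt0) ltac:(by rewrite divr_ge0 ?mulr_ge0 ?ltW).
  have h0 : 0 < `|h|.
    rewrite normr_gt0; apply/eqP => hz; move: hw.
    by rewrite hz evaluation0 // !normr0 mulr0 ltxx.
  pose k := (rho / 2 / `|h|) *: h.
  have nk : `|k| = rho / 2.
    by rewrite normrZ ger0_norm ?divfK ?gt_eqF // ltW // !divr_gt0.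
  have ek : N < `|e w k|.
    rewrite /k evaluationZ // normrM ger0_norm; last by rewrite ltW // !divr_gt0.
    rewrite mulrAC ltr_pdivlMr // -ltr_pdivrMl ?divr_gt0 //.
    apply: le_lt_trans hw; rewrite invf_div mulrA.
    by rewrite [2 / rho * N]mulrC mulrA.
  (* e w k is half the difference of the values at x + k and x - k, so one of
     the two values is large. *)
  have [x' xx' ex'] : exists2 x', `|x' - x| = rho / 2 & N <= `|e w x'|.
    apply: contrapT => nx.
    have lt1 x' : `|x' - x| = rho / 2 -> `|e w x'| < N.
      move=> hx; rewrite real_ltNge ?normr_real ?gtr0_real //.
      by apply/negP => hN; apply: nx; exists x'.
    have h1 := lt1 (x + k) ltac:(by rewrite [x + k]addrC addrK).
    have h2 := lt1 (x - k) ltac:(by rewrite [x - k]addrC addrK normrN).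
    suff : N < N by rewrite ltxx.
    apply: lt_trans ek _.
    have -> : e w k = (e w (x + k) - e w (x - k)) / 2.
      rewrite -evaluationB // opprB addrC addrA subrK.
      have -> : k + k = 2 *: k by rewrite scaler_nat mulr2n.
      by rewrite (evaluationZ 2 k Ew) mulrAC divff ?pnatr_eq0 // mul1r.
    rewrite norm_half ltr_pdivrMr //; apply: le_lt_trans (ler_normB _ _) _.
    by rewrite mulr_natr mulr2n ltrD.
  have [M M0 hM] := e_bounded Ew.
  have M1 : 0 < (M + 1)^-1 by rewrite invr_gt0 ltr_wpDl.
  have rp2 : 0 < rho / 2 by rewrite divr_gt0.
  have [rho' [rp' r1 r2]] := min_pos rp2 M1.
  exists (x', rho'); split => /=.
  + split => //= _; exists w; split => // y yx.
    have : `|e w y - e w x'| <= 1.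
      rewrite -evaluationB //; apply: le_trans (hM _) _.
      apply: (@le_trans _ _ ((M + 1) * rho')).
        by apply: ler_pM => //; rewrite lerDl.
      by rewrite -ler_pdivlMl ?mulr1 // ltr_wpDl.
    move=> h3; have : N - `|e w y| <= 1.
      apply: le_trans h3; rewrite distrC; apply: le_trans (lerB_dist _ _).
      by rewrite lerD2r.
    by rewrite lerBlDr /N [1 + _]addrC lerD2r.
  + by rewrite xx' [X in _ <= X]splitr lerD2l.
  + exact: ltW.
  + by [].
move=> s [z hs].
have [r r1 hr] := differentiable_near (e_diff z Eu) (ltr01 : (0 : C) < 1).
have [n1 hn1] := half_pow_small (ltW r00) r1.
have [n2 hn2] := half_pow_small (D := `|e u z| + 1) (e := 1) ltac:(by rewrite addr_ge0) ltr01.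
pose n := (n1 + n2).+1.
have [[_ /(_ isT)[w [wu Ew hw]]] zs _] := hs n.
have pow_le i : (i <= n)%N -> (2 : C) ^+ i <= 2 ^+ n.
  by move=> ii; rewrite ler_weXn2l // ler1n.
have wr : `|w - u| < r.
  apply: lt_trans wu _; apply: le_lt_trans hn1; rewrite ler_wpM2l ?(ltW r00) //.
  by rewrite lef_pV2 ?posrE ?exprn_gt0 // pow_le // ltnW // ltnS leq_addr.
have h1 := hw _ zs.
have h2 : 2 ^+ n < `|e u z| + 1.
  apply: le_lt_trans h1 _; rewrite -(subrK (e u z) (e w z)).
  by apply: le_lt_trans (ler_normD _ _) _; rewrite addrC ltrD2l; apply: hr.
suff : (2 : C) ^+ n < 2 ^+ n by rewrite ltxx.
apply: lt_le_trans h2 _.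
apply: le_trans (pow_le n2 _); last by rewrite ltnW // ltnS leq_addl.
by apply/ltW; move: hn2; rewrite ltr_pdivrMr ?exprn_gt0 // mul1r.
Qed.

Section Division.
Variables (g : V -> C) (u0 : V).
Hypothesis g_diff : forall u, E u -> differentiable g u.
Hypothesis Eu0 : E u0.
Hypothesis g_nz : forall r : C, 0 < r -> exists2 w, `|w - u0| < r & g w != 0.

(** g is bounded near u0 by continuity; restrictions of g to complex lines
    through points near u0 then meet the hypotheses of the one variable
    lemmas. *)
Lemma bounded_disc : exists r M : C, 0 < r /\ forall w, `|w - u0| < r -> E w /\ `|g w| <= M.
Proof.
have [r1 r10 h1] := ball_in_open Eu0.
have [r2 r20 h2] := differentiable_near (g_diff Eu0) (ltr01 : (0 : C) < 1).
have [r [r0 rr1 rr2]] := min_pos r10 r20.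
exists r, (`|g u0| + 1); split=> // w wr; split; first by apply: h1; apply: lt_le_trans wr _.
rewrite -(subrK (g u0) (g w)) addrC; apply: le_trans (ler_normD _ _) _.
by rewrite lerD2l ltW // h2 // (lt_le_trans wr).
Qed.

(** A complex line through u0 and a nearby point where g does not vanish:
    zeros of g on it cannot cluster at u0, so a small square around u0 avoids
    them. *)
Lemma nonvanishing_square (r M : C) : 0 < r ->
  (forall w, `|w - u0| < r -> E w /\ `|g w| <= M) ->
  exists2 v : V, `|v| < r / 32 & forall z, square_bd z -> g (u0 + z *: v) != 0.
Proof.
move=> r0 hr.
have r64 : 0 < r / 64 by rewrite divr_gt0.
have [u1 u1r gu1] := g_nz r64.
pose v1 := 2 *: (u1 - u0).
have nv1 : `|v1| < r / 32.
  rewrite normrZ ger0_norm // -ltr_pdivlMl //; apply: lt_le_trans u1r _.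
  by rewrite -[X in _ <= X]mulrC -mulrA -invfM -natrM.
have inr t : `|t| <= 2 -> `|u0 + t *: v1 - u0| < r.
  move=> t2; rewrite [u0 + _]addrC addrK normrZ; apply: (@le_lt_trans _ _ (2 * (r / 32))).
    by apply: ler_pM => //; exact: ltW.
  by rewrite mulrCA gtr_pMr // ltr_pdivrMr // mul1r ltr_nat.
pose f := line g u0 v1.
have df t : `|t| <= 2 -> differentiable f t.
  by move=> t2; apply: line_differentiable; apply: g_diff; exact: (hr _ (inr t t2)).1.
have fM z : square_bd z -> `|f z| <= M.
  by move=> /square_bd_norm/andP[_ z2]; exact: (hr _ (inr z z2)).2.
have [d d0 hd] : exists2 d : C, 0 < d & forall z, z != 0 -> `|z| < d -> f z != 0.
  apply: contrapT => nd.
  have f0 : forall a, `|a| <= 2^-1 -> f a = 0.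
    apply: (zeros_cluster df fM) => d d0.
    apply: contrapT => nz; apply: nd; exists d => // z z0 zd; apply/eqP => fz.
    by apply: nz; exists z.
  move: gu1; have := f0 2^-1; rewrite normV2 => /(_ (lexx _)).
  rewrite /f /v1 scalerA mulVf ?pnatr_eq0 // scale1r addrC subrK => ->.
  by rewrite eqxx.
have d40 : 0 < d / 4 by rewrite divr_gt0.
have [s [s0 s1 sd]] := min_pos (ltr01 : (0 : C) < 1) d40.
exists (s *: v1).
  rewrite normrZ gtr0_norm //; apply: le_lt_trans nv1.
  by rewrite -[X in _ <= X]mul1r ler_wpM2r.
move=> z zb; rewrite scalerA; apply: hd.
  have /andP[z1 _] := square_bd_norm zb.
  apply: mulf_neq0; last by rewrite gt_eqF.
  by rewrite -normr_gt0 (lt_le_trans ltr01).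
have /andP[_ z2] := square_bd_norm zb.
rewrite normrM (gtr0_norm s0); apply: (@le_lt_trans _ _ (2 * (d / 4))).
  by apply: ler_pM => //; exact: ltW.
by rewrite mulrCA gtr_pMr // ltr_pdivrMr // mul1r ltr_nat.
Qed.

(** By compactness of the square, the lower bound for g and the upper bound
    for the evaluations are uniform along the square, also after moving its
    centre slightly. A single exponent N serves as radius and as constant. *)
Lemma uniform_division (v : V) : (forall z, square_bd z -> E (u0 + z *: v)) ->
  (forall z, square_bd z -> g (u0 + z *: v) != 0) ->
  exists N : nat, forall z, square_bd z -> forall u, `|u - u0| < 2 ^- N ->
    g (u + z *: v) != 0 /\ forall h, 2 ^- N * `|e (u + z *: v) h| <= `|h| * `|g (u + z *: v)|.
Proof.
move=> Ev gv.
(* The near covering form of compactness, along the filter of large n. *)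
pose P (n : nat) (z : C) := forall u, `|u - u0| < 2 ^- n ->
    g (u + z *: v) != 0 /\ forall h, 2 ^- n * `|e (u + z *: v) h| <= `|h| * `|g (u + z *: v)|.
have p0 n : 0 < (2 : C) ^- n by rewrite invr_gt0 exprn_gt0.
have pmono i n : (i <= n)%N -> (2 : C) ^- n <= 2 ^- i.
  by move=> i_n; rewrite lef_pV2 ?posrE ?exprn_gt0 // ler_weXn2l // ler1n.
have psmall (d : C) : 0 < d -> exists n, 2 ^- n < d.
  by move=> d0; have [n hn] := half_pow_small ler01 d0; exists n; rewrite -div1r.
have cover : near_covering square_bd by apply/compact_near_coveringP.
have local : forall z, square_bd z -> \forall z' \near z & n \near \oo, P n z'.
  move=> z zb; pose u2 := u0 + z *: v.
  have [M M0 [r1 r10 hM]] := locally_bounded_evaluation (Ev z zb).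
  have g20 : 0 < `|g u2| / 2 by rewrite divr_gt0 // normr_gt0 gv.
  have [r2 r20 hg] := differentiable_near (g_diff (Ev z zb)) g20.
  have [r [r0 rr1 rr2]] := min_pos r10 r20.
  have r20' : 0 < r / 2 by rewrite divr_gt0.
  have [N1 hN1] := psmall _ r20'.
  have M1 : 0 < M + 1 by rewrite ltr_wpDl.
  have [N2 hN2] := psmall (`|g u2| / 2 / (M + 1)) ltac:(by rewrite divr_gt0).
  have v1 : 0 < `|v| + 1 by rewrite ltr_wpDl.
  have rv : 0 < r / 2 / (`|v| + 1) by rewrite divr_gt0.
  exists (ball z (r / 2 / (`|v| + 1)), [set n | (maxn N1 N2 <= n)%N]) => /=.
    by split; [exact: nbhsx_ballx | exists (maxn N1 N2)].
  move=> [z' n] /= [zz' ]; rewrite geq_max => /andP[n1 n2] u uu0.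
  have zz'' : `|z' - z| < r / 2 / (`|v| + 1) by move: zz'; rewrite -ball_normE /= distrC.
  have uu2 : `|u + z' *: v - u2| < r.
    have -> : u + z' *: v - u2 = (u - u0) + (z' - z) *: v.
      by rewrite /u2 scalerBl opprD addrACA.
    apply: le_lt_trans (ler_normD _ _) _; rewrite [X in _ < X]splitr; apply: ltrD.
      by apply: lt_trans uu0 _; apply: le_lt_trans hN1; exact: pmono.
    rewrite normrZ; apply: (@le_lt_trans _ _ (`|z' - z| * (`|v| + 1))).
      by rewrite ler_wpM2l // lerDl.
    by rewrite -ltr_pdivlMr.
  have gge : `|g u2| / 2 < `|g (u + z' *: v)|.
    have := hg _ (lt_le_trans uu2 rr2); rewrite distrC => h.
    have := le_lt_trans (lerB_dist _ _) h; rewrite ltrBlDl [X in X < _ -> _]splitr.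
    by rewrite [`|g (u + _)| + _]addrC ltrD2l.
  split; first by rewrite -normr_gt0 (lt_trans g20).
  move=> h; have [_ hh] := hM _ (lt_le_trans uu2 rr1).
  apply: (@le_trans _ _ (2 ^- n * ((M + 1) * `|h|))).
    rewrite ler_wpM2l ?(ltW (p0 n)) //; apply: le_trans (hh h) _.
    by rewrite ler_wpM2r // lerDl.
  rewrite mulrA mulrC ler_wpM2l // -ler_pdivlMr //.
  apply: le_trans (pmono _ _ n2) _; apply: le_trans (ltW hN2) _.
  by rewrite ler_pM2r ?invr_gt0 // ltW.
have [N _ hN] := cover nat \oo P _ local.
by exists N => z zb; exact: (hN N (leqnn N) z zb).
Qed.

(** If h = q g with q entire, then q is bounded by a multiple of the norm of h
    on a square where g stays away from 0, and hence at the centre of the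
    square. In particular g cannot vanish identically near the centre, by
    isolation of zeros. *)
Lemma local_division : exists r K : C, [/\ 0 < r, 0 <= K & forall u, `|u - u0| < r ->
  [/\ E u, (forall d : C, 0 < d -> exists2 w, `|w - u| < d & g w != 0) &
    forall (q : V -> C) h, (forall w, differentiable q w) ->
      (forall w, E w -> e w h = q w * g w) -> `|q u| <= K * `|h|]].
Proof.
have [r [M [r0 hr]]] := bounded_disc.
have [v vr gv] := nonvanishing_square r0 hr.
have r320 : 0 < r / 32 by rewrite divr_gt0.
have vr8 t : `|t| <= 8 -> `|t *: v| < r / 2.
  move=> t8; rewrite normrZ; apply: (@le_lt_trans _ _ (8 * (r / 32))).
    by apply: ler_pM => //; exact: ltW.
  by rewrite mulrCA ltr_pM2l // ltr_pdivrMr // mulrC ltr_pdivlMr // -natrM ltr_nat.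
have in8 u t : `|u - u0| < r / 2 -> `|t| <= 8 -> `|u + t *: v - u0| < r.
  move=> ur t8; rewrite addrAC; apply: le_lt_trans (ler_normD _ _) _.
  by rewrite [X in _ < X]splitr ltrD // vr8.
have r20 : 0 < r / 2 by rewrite divr_gt0.
have z8 z : square_bd z -> `|z| <= 8.
  by move=> /square_bd_norm/andP[_ z2]; apply: le_trans z2 _; rewrite ler_nat.
have Ev z : square_bd z -> E (u0 + z *: v).
  by move=> /z8 zb; apply: (hr _ _).1; apply: in8 => //; rewrite subrr normr0.
have [N hN] := uniform_division Ev gv.
have p0 : 0 < (2 : C) ^- N by rewrite invr_gt0 exprn_gt0.
have [r1 [r10 rr rN]] := min_pos r20 p0.
exists r1, (32 * 2 ^+ N); split=> //.
move=> u ur1; have ur := lt_le_trans ur1 rr; have uN := lt_le_trans ur1 rN.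
have Eu t : `|t| <= 8 -> E (u + t *: v) by move=> t8; apply: (hr _ (in8 u t ur t8)).1.
split.
- by have := Eu 0; rewrite scale0r addr0; apply; rewrite normr0.
- move=> d d0; apply: contrapT => nd.
  (* The factor 4 brings the point u + v, where g does not vanish, into the
     disc of radius 1/2 where f vanishes. *)
  pose f := line g u (4 *: v).
  have n4 (t : C) : `|t| <= 2 -> `|t * 4| <= 8.
    by move=> t2; rewrite normrM normr_nat (_ : 8 = 2 * 4) ?ler_pM2r // -natrM.
  have df t : `|t| <= 2 -> differentiable f t.
    by move=> t2; apply: line_differentiable; apply: g_diff; rewrite scalerA; apply: Eu; exact: n4.
  have fM z : square_bd z -> `|f z| <= M.
    move=> /square_bd_norm/andP[_ z2]; rewrite /f /= scalerA.
    have z4 := n4 z z2; have h := in8 u (z * 4) ur z4.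
    by have [] := hr _ h.
  have f0 : forall a, `|a| <= 2^-1 -> f a = 0.
    apply: (zeros_cluster df fM) => d' d'0.
    have v1 : 0 < `|4 *: v| + 1 by rewrite ltr_wpDl.
    have [s [s0 s1 s2]] := min_pos d'0 (divr_gt0 d0 v1).
    exists (s / 2); split; first by rewrite gt_eqF // divr_gt0.
      rewrite gtr0_norm ?divr_gt0 //; apply: lt_le_trans s1.
      by rewrite ltr_pdivrMr // ltr_pMr // ltr1n.
    apply: contrapT => /eqP fz; apply: nd; exists (u + (s / 2) *: (4 *: v)) => //.
    rewrite [u + _]addrC addrK normrZ gtr0_norm ?divr_gt0 //.
    apply: (@le_lt_trans _ _ (s / 2 * (`|4 *: v| + 1))).
      by rewrite ler_wpM2l ?lerDl // divr_ge0 // ltW.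
    rewrite mulrAC ltr_pdivrMr //; apply: (@le_lt_trans _ _ d).
      by rewrite -ler_pdivlMr.
    by rewrite ltr_pMr // ltr1n.
  have b1 : square_bd (1 : C) by exact: square_bd1.
  have [/negP gne _] := hN 1 b1 u uN; apply: gne.
  have := f0 (4^-1) ; rewrite /f /= scalerA mulVf ?pnatr_eq0 // => -> //.
  by rewrite ger0_norm ?invr_ge0 // lef_pV2 ?posrE // ler_nat.
move=> q h dq hq; pose f := line q u v.
have df t : `|t| <= 2 -> differentiable f t by move=> _; apply: line_differentiable; exact: dq.
have fM z : square_bd z -> `|f z| <= 2 ^+ N * `|h|.
  move=> zb; have [gne /(_ h)] := hN z zb u uN.
  rewrite hq; last by apply: Eu; exact: z8.
  rewrite normrM mulrA ler_pM2r ?normr_gt0 // => h1.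
  by rewrite mulrC -ler_pdivrMr ?exprn_gt0 // mulrC.
have z0 : `|0 : C| <= 2^-1 by rewrite normr0 invr_ge0.
have := norm_value_le df fM z0.
by rewrite /f scale0r addr0 mulrA.
Qed.

End Division.

Variables (g : V -> C) (P : set (V -> C)).
Hypothesis g_diff : forall u, E u -> differentiable g u.
Hypothesis P_diff : forall q, P q -> forall w, differentiable q w.
Hypothesis P_lin : forall (c : C) q q', P q -> P q' -> P (fun w => c * q w + q' w).

Definition multiple q h := P q /\ forall w, E w -> e w h = q w * g w.
Hypothesis multiple_dense : forall h (d : C), 0 < d -> exists q h', multiple q h' /\ `|h - h'| < d.

Definition not_locally_null u := E u /\ forall d : C, 0 < d -> exists2 w, `|w - u| < d & g w != 0.

Lemma multiple_lin (c : C) q h q' h' : multiple q h -> multiple q' h' ->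
  multiple (fun w => c * q w + q' w) (c *: h + h').
Proof.
move=> [Pq hq] [Pq' hq']; split; first exact: P_lin.
by move=> w Ew; rewrite e_linear // hq // hq' // mulrDl mulrA.
Qed.

Lemma multiple_le u0 : not_locally_null u0 -> exists r K : C, [/\ 0 < r, 0 <= K &
  forall u, `|u - u0| < r -> not_locally_null u /\ forall q h, multiple q h -> `|q u| <= K * `|h|].
Proof.
move=> [Eu0 gu0]; have [r [K [r0 K0 h]]] := local_division g_diff Eu0 gu0.
exists r, K; split=> // u /h[Eu gu hq]; split; first by [].
by move=> q k [Pq]; apply: hq; exact: P_diff.
Qed.

(** The quotient of h by g at u is the limit of q_n(u) for any multiples q_n g
    that tend to h: by [local_division] the limit exists and depends only on
    h. *)
Lemma quotient_exists : exists theta : V -> Y -> C,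
  forall u0, not_locally_null u0 -> exists r K : C, [/\ 0 < r, 0 <= K &
  forall u, `|u - u0| < r -> not_locally_null u /\
    forall q h' h, multiple q h' -> `|theta u h - q u| <= K * `|h - h'|].
Proof.
have [A hA] : exists A : Y * nat -> (V -> C) * Y, forall hn,
    multiple (A hn).1 (A hn).2 /\ `|hn.1 - (A hn).2| < 2 ^- hn.2.
  suff /choice[A hA] : forall hn : Y * nat, exists qh : (V -> C) * Y,
    multiple qh.1 qh.2 /\ `|hn.1 - qh.2| < 2 ^- hn.2 by exists A.
  move=> [h n]; have [] := @multiple_dense h (2 ^- n); first by rewrite invr_gt0 exprn_gt0.
  by move=> q [h' ?]; exists (q, h').
exists (fun u h => xget 0 [set l | lim_seq (fun n => (A (h, n)).1 u) l]) => u0 /multiple_le[r [K [r0 K0 hK]]].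
exists r, K; split=> // u /hK[nu hq]; split=> // q h' h qh'.
have p0 n : 0 <= (2 : C) ^- n by rewrite invr_ge0 exprn_ge0.
have hdist i : `|h - (A (h, i)).2| <= 2 ^- i by apply/ltW; case: (hA (h, i)).
have : exists l, lim_seq (fun n => (A (h, n)).1 u) l.
  apply: C_complete; apply: (fast_cauchy K0) => i j.
  have := hq _ _ (multiple_lin (-1) (hA (h, j)).1 (hA (h, i)).1).
  rewrite mulN1r scaleN1r [- _ + _]addrC [- _ + (A (h, i)).2]addrC => /le_trans; apply.
  rewrite ler_wpM2l //; apply: le_trans (ler_distD h _ _) _.
  by apply: lerD => //; rewrite distrC.
move=> /(@xgetPex _ 0) /= hl.
have B0 : 0 <= K * `|h - h'| by rewrite mulr_ge0.
apply: (lim_seq_dist K0 (ger0_real B0) hl) => n.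
have := hq _ _ (multiple_lin (-1) qh' (hA (h, n)).1).
rewrite mulN1r scaleN1r [- _ + _]addrC [- _ + (A (h, n)).2]addrC => /le_trans; apply.
rewrite -mulrDr ler_wpM2l //; apply: le_trans (ler_distD h _ _) _.
by rewrite addrC; apply: lerD => //; rewrite distrC.
Qed.

(** The quotient is linear and bounded in h as a limit of the functionals of
    [multiple_le]. It is holomorphic in u because the q_n satisfy second order
    Taylor estimates with the same constants, and their differentials at u
    form a Cauchy sequence. *)
Lemma quotient_functional : exists theta : V -> Y -> C, forall u, not_locally_null u ->
  [/\ forall (c : C) h k, theta u (c *: h + k) = c * theta u h + theta u k,
      exists2 K : C, 0 <= K & forall h, `|theta u h| <= K * `|h|,
      forall h, g u * theta u h = e u h &
      forall h, differentiable (fun w => theta w h) u].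
Proof.
have [theta ht] := quotient_exists; exists theta => u nu.
have [r [K [r0 K0 hK]]] := ht u nu.
have uu : `|u - u| < r by rewrite subrr normr0.
have [_ hKu] := hK u uu.
have seqs h : exists A : nat -> (V -> C) * Y, forall n,
    multiple (A n).1 (A n).2 /\ `|h - (A n).2| < 2 ^- n.
  suff /choice[A hA] : forall n : nat, exists qh : (V -> C) * Y,
    multiple qh.1 qh.2 /\ `|h - qh.2| < 2 ^- n by exists A.
  move=> n; have [] := @multiple_dense h (2 ^- n); first by rewrite invr_gt0 exprn_gt0.
  by move=> q [h' ?]; exists (q, h').
have approx w h : `|w - u| < r -> forall A : nat -> (V -> C) * Y,
    (forall n, multiple (A n).1 (A n).2 /\ `|h - (A n).2| < 2 ^- n) ->
    lim_seq (fun n => (A n).1 w) (theta w h).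
  move=> wr A hA d d0; have [_ hw] := hK w wr.
  have [n hn] := half_pow_small K0 d0; exists n => i ni.
  rewrite distrC; have [mi /ltW hi] := hA i; apply: le_lt_trans (hw _ _ h mi) _.
  apply: le_lt_trans hn; rewrite ler_wpM2l //; apply: le_trans hi _.
  by rewrite lef_pV2 ?posrE ?exprn_gt0 // ler_weXn2l // ler1n.
have mult_eq w q h : `|w - u| < r -> multiple q h -> theta w h = q w.
  move=> wr qh; have [_ hw] := hK w wr; have := hw q h h qh.
  by rewrite subrr normr0 mulr0 normr_le0 subr_eq0 => /eqP.
have th_le w h : `|w - u| < r -> `|theta w h| <= K * `|h|.
  move=> wr; have [q0 [h0 [m0 _]]] := multiple_dense 0 (ltr01 : (0 : C) < 1).
  have m1 := multiple_lin (-1) m0 m0.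
  have [_ hw] := hK w wr; have := hw _ _ h m1.
  by rewrite mulN1r addNr subr0 scaleN1r addNr subr0.
have lin w : `|w - u| < r -> forall (c : C) h k, theta w (c *: h + k) = c * theta w h + theta w k.
  move=> wr c h k; have [A hA] := seqs h; have [B hB] := seqs k.
  have l1 := lim_seq_lin c (approx _ _ wr _ hA) (approx _ _ wr _ hB).
  apply/eqP; rewrite -subr_eq0 -normr_le0; have [_ hw] := hK w wr.
  have D0 : 0 <= K * (`|c| + 1) by rewrite mulr_ge0 // addr_ge0.
  rewrite distrC; apply: (lim_seq_dist D0 _ l1) => // n.
  have [mA /ltW dA] := hA n; have [mB /ltW dB] := hB n.
  rewrite distrC; have := hw _ _ (c *: h + k) (multiple_lin c mA mB) => /le_trans; apply.
  rewrite add0r -mulrA ler_wpM2l // mulrDl mul1r opprD addrACA -scalerBr.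
  by apply: le_trans (ler_normD _ _) _; rewrite normrZ; apply: lerD => //; rewrite ler_wpM2l.
split.
- exact: lin.
- by exists K => // h; apply: th_le.
- move=> h; have [A hA] := seqs h; have Eu := nu.1.
  have [M M0 hM] := e_bounded Eu.
  have D0 : 0 <= M by [].
  have l1 := lim_seq_lin (g u) (approx _ _ uu _ hA) (approx _ _ uu _ hA).
  apply/eqP; rewrite -subr_eq0 -normr_le0.
  have l2 : lim_seq (fun n => g u * (A n).1 u) (g u * theta u h).
    have z : lim_seq (fun n : nat => 0 : C) 0 by move=> d d0; exists 0%N => i _; rewrite subrr normr0.
    have := lim_seq_lin (g u) (approx _ _ uu _ hA) z.
    by rewrite addr0; under eq_fun do rewrite addr0.
  apply: (lim_seq_dist M0 _ l2) => // n.
  have [[_ mA] /ltW dA] := hA n.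
  rewrite add0r mulrC -mA // -(mulrN1 (e u h)) [_ * -1]mulrC addrC -e_linear // scaleN1r.
  apply: le_trans (hM _) _; rewrite ler_wpM2l //.
  by rewrite addrC distrC.
move=> h.
have [A hA] := seqs h.
have [K2 K20 hT] := taylor2_ball.
have hdist i : `|h - (A i).2| <= 2 ^- i by apply/ltW; case: (hA i).
pose Q n := (A n).1.
have qdiff i w : differentiable (A i).1 w by apply: P_diff; case: (hA i) => -[].
have dq i j w d : 'd (fun w => (A i).1 w - (A j).1 w) w d = 'd (Q i) w d - 'd (Q j) w d.
  by rewrite (_ : (fun w => _) = (A i).1 \- (A j).1) // diffB.
have dqd i j w : differentiable (fun w => (A i).1 w - (A j).1 w) w.
  by apply: differentiableB.
have sub_le i j w : `|w - u| < r -> `|(A i).1 w - (A j).1 w| <= K * (2 ^- i + 2 ^- j).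
  move=> wr; have := multiple_lin (-1) (hA j).1 (hA i).1 => /(mult_eq _ _ _ wr).
  have := th_le w ((A i).2 - (A j).2) wr.
  rewrite scaleN1r mulN1r [- _ + (A i).2]addrC [- _ + (A i).1 w]addrC => + <- => /le_trans; apply.
  rewrite ler_wpM2l //; apply: le_trans (ler_distD h _ _) _.
  by apply: lerD => //; rewrite distrC.
have ddist d i j : `|'d (Q i) u d - 'd (Q j) u d| <= K2 * K * (`|d| / r) * (2 ^- i + 2 ^- j).
  rewrite -dq; have [h1 _] := hT V _ u r _ r0 (dqd i j) (sub_le i j) d.
  by apply: le_trans h1 _; rewrite le_eqVlt; apply/orP; left; apply/eqP; ring.
have [L hL] : exists L : V -> C, forall d, lim_seq (fun n => 'd (Q n) u d) (L d).
  suff /choice[L hL] : forall d, exists l, lim_seq (fun n => 'd (Q n) u d) l by exists L.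
  move=> d.
  apply: C_complete; apply: (fast_cauchy _ (ddist d)).
  by rewrite !mulr_ge0 ?invr_ge0 ?(ltW r0).
have linL : linear L.
  move=> c x y; have l1 := lim_seq_lin c (hL x) (hL y).
  apply: (lim_seq_uniq _ l1) => d d0; have [N hN] := hL (c *: x + y) d d0.
  by exists N => i /hN; rewrite linearP.
pose B := K * (`|h| + 1).
have B0 : 0 <= B by rewrite mulr_ge0 // addr_ge0.
have qB n w : `|w - u| < r -> `|(A n).1 w| <= B.
  move=> wr; rewrite -(mult_eq w _ _ wr (hA n).1); apply: le_trans (th_le _ _ wr) _.
  rewrite ler_wpM2l // -[X in `|X|](subrK h) addrC; apply: le_trans (ler_normD _ _) _.
  rewrite lerD2l distrC; apply: le_trans (hdist n) _.
  by rewrite invf_le1 ?exprn_gt0 // exprn_ege1 // ler1n.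
have L_le d : `|L d| <= K2 * B / r * `|d|.
  have D0 : 0 <= K2 * B / r * `|d| by rewrite !mulr_ge0 // invr_ge0 ltW.
  rewrite -[L d]subr0; apply: (lim_seq_dist (lexx 0) (ger0_real D0) (hL d)) => n.
  rewrite subr0 mul0r addr0; have [h1 _] := hT V _ u r _ r0 (qdiff n) (qB n) d.
  by apply: le_trans h1 _; rewrite le_eqVlt; apply/orP; left; apply/eqP; ring.
pose Llin : {linear V -> C} := HB.pack L (GRing.isLinear.Build _ _ _ _ L linL).
have cL : continuous Llin.
  apply/linear_bounded_continuous/linear_boundedP.
  exists (K2 * B / r); split; first by rewrite ger0_real // !mulr_ge0 // invr_ge0 ltW.
  move=> M hM x; apply: le_trans (L_le x) _; by rewrite ler_wpM2r // ltW.
apply: (approx_differentiable cL) => d d0.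
pose D := K2 * B / r ^+ 2.
have D0 : 0 <= D by rewrite !mulr_ge0 // invr_ge0 exprn_ge0 // ltW.
have r80 : 0 < r / 8 by rewrite divr_gt0.
have dD0 : 0 < d / (D + 1) by rewrite divr_gt0 // ltr_wpDl.
have [s [s0 s1 s2]] := min_pos r80 dD0.
exists s => // x xs.
have xr8 : `|x| <= r / 8 by apply: le_trans (ltW xs) s1.
have xr : `|u + x - u| < r.
  rewrite [u + x]addrC addrK; apply: le_lt_trans xr8 _.
  by rewrite ltr_pdivrMr // ltr_pMr // ltr1n.
apply: (@le_trans _ _ (D * `|x| ^+ 2)).
  rewrite [x + u]addrC -[X in `|X|]subr0.
  have lz : lim_seq (fun n => Q n (u + x) - Q n u - 'd (Q n) u x)
     (theta (u + x) h - theta u h - Llin x).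
    have l1 := lim_seq_lin (-1) (approx _ _ uu _ hA) (approx _ _ xr _ hA).
    have l2 := lim_seq_lin (-1) (hL x) l1.
    move=> eps eps0; have [N hN] := l2 eps eps0; exists N => i /hN.
    by rewrite !scaleN1r -[Llin x]/(L x) /Q; congr (`|_| < _); ring.
  have DD : 0 <= D * `|x| ^+ 2 by rewrite mulr_ge0 // exprn_ge0.
  apply: (lim_seq_dist (lexx 0) (ger0_real DD) lz) => n.
  rewrite mul0r addr0 subr0; have [_ /(_ xr8) h2] := hT V _ u r _ r0 (qdiff n) (qB n) x.
  apply: le_trans h2 _; rewrite le_eqVlt; apply/orP; left; apply/eqP; rewrite /D; field.
  by rewrite gt_eqF.
rewrite expr2 mulrA ler_wpM2r //; apply: (@le_trans _ _ ((D + 1) * `|x|)).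
  by rewrite ler_wpM2r // lerDl.
have D1 : 0 < D + 1 by rewrite ltr_wpDl.
by rewrite mulrC -ler_pdivlMr //; apply: le_trans (ltW xs) s2.
Qed.

End ComplexAnalysis.

(** * The field R[i] *)

Section ComplexNumbers.
Variable R : realType.
Local Notation C := (Cplx R).

Definition toC (x : R) : C := (x%:C)%C.

Lemma normC_le_ReIm (z : C) :
  `|z| <= toC (`|complex.Re z| + `|complex.Im z|).
Proof.
have e : z = toC (complex.Re z) + 'i * toC (complex.Im z) by exact: complexE.
rewrite {1}e; apply: (le_trans (ler_normD _ _)).
rewrite normrM normCi mul1r.
have nR (x : R) : `|toC x| = toC `|x|.
  by rewrite [LHS](@normc_def R) /= expr0n addr0 sqrtr_sqr.
by rewrite !nR -[X in X <= _](rmorphD (real_complex R)).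
Qed.

Lemma abs_Re_le (z : C) : toC `|complex.Re z| <= `|z|.
Proof. exact: normc_ge_Re. Qed.

Lemma abs_Im_le (z : C) : toC `|complex.Im z| <= `|z|.
Proof.
have -> : `|z| = `|('i : C) * z| by rewrite normrM normCi mul1r.
apply: le_trans (abs_Re_le _).
by case: z => a b /=; rewrite mul0r mul1r sub0r normrN.
Qed.

Lemma toC_ltP (e : C) : 0 < e -> exists2 d : R, 0 < d & e = toC d.
Proof.
case: e => a b; rewrite ltcE /= => /andP[/eqP -> a0]; exists a => //.
Qed.

Lemma real_cauchy_cvg (u : nat -> R) :
  (forall e, 0 < e -> exists N, forall i j, (N <= i)%N -> (N <= j)%N ->
    `|u i - u j| < e) -> exists l, forall e, 0 < e -> exists N, forall i,
    (N <= i)%N -> `|u i - l| < e.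
Proof.
move=> cu.
have /cauchy_cvg cvu : cauchy (u @ \oo).
  apply/cauchy_ballP => e e0; have [N hN] := cu _ e0.
  exists (u @` [set k | (N <= k)%N], u @` [set k | (N <= k)%N]) => /=.
    by split; exists N => // k /= Nk; exists k.
  by move=> [_ _] [[i Ni <-] [j Nj <-]]; rewrite -ball_normE; apply: hN.
exists (lim (u @ \oo)) => e e0; move/cvgrPdist_lt : cvu => /(_ e e0) [N _ hN].
by exists N => i Ni; rewrite distrC; apply: hN.
Qed.

Lemma complex_complete : @seq_complete C C.
Proof.
move=> u cu.
have [a ha] : exists l, forall e, 0 < e -> exists N, forall i,
    (N <= i)%N -> `|complex.Re (u i) - l| < e.
  apply: real_cauchy_cvg => e e0; have [|N hN] := cu (toC e).
    by rewrite ltcR.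
  exists N => i j Ni Nj; rewrite -ltcR; apply: le_lt_trans (hN i j Ni Nj).
  apply: le_trans (abs_Re_le _).
  by case: (u i) (u j) => [x1 x2] [y1 y2].
have [b hb] : exists l, forall e, 0 < e -> exists N, forall i,
    (N <= i)%N -> `|complex.Im (u i) - l| < e.
  apply: real_cauchy_cvg => e e0; have [|N hN] := cu (toC e).
    by rewrite ltcR.
  exists N => i j Ni Nj; rewrite -ltcR; apply: le_lt_trans (hN i j Ni Nj).
  apply: le_trans (abs_Im_le _).
  by case: (u i) (u j) => [x1 x2] [y1 y2].
exists (Complex a b : C) => _ /toC_ltP[e e0 ->].
have e20 : 0 < e / 2 by rewrite divr_gt0.
have [N1 h1] := ha _ e20; have [N2 h2] := hb _ e20.
exists (maxn N1 N2) => i; rewrite geq_max => /andP[/h1 k1 /h2 k2].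
apply: le_lt_trans (normC_le_ReIm _) _.
have := ltrD k1 k2; rewrite -splitr; rewrite -ltcR => h; apply: le_lt_trans h.
by case: (u i) {k1 k2} => [x1 x2] /=.
Qed.

Lemma complex_half_pow_null : half_pow_null C.
Proof.
move=> D e D0 /toC_ltP[d d0 ->].
have -> : D = toC (complex.Re D).
  by case: D D0 => a b; rewrite lecE /= => /andP[/eqP-> _].
have [n hn] : exists n : nat, complex.Re D / d < n%:R.
  by exists (Num.truncn (`|complex.Re D / d|)).+1; apply: le_lt_trans (ler_norm _) _;
     apply: Num.Theory.truncnS_gt.
exists n; rewrite ltr_pdivrMr ?exprn_gt0 //.
have -> : toC d * 2 ^+ n = toC (d * 2 ^+ n).
  by rewrite /toC rmorphM rmorphXn rmorph_nat.
rewrite ltcR; move: hn; rewrite ltr_pdivrMr // mulrC => h; apply: lt_trans h _.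
by rewrite ltr_pM2l // -natrX ltr_nat ltn_expl.
Qed.

End ComplexNumbers.

Lemma real_ultralimit (R : realType) (U : set_system nat) (s : nat -> R) (M : R) :
  UltraFilter U -> (forall k, `|s k| <= M) ->
  exists l, forall e, 0 < e -> U [set k | `|s k - l| < e].
Proof.
move=> UU sM; have PU : ProperFilter U by apply: ultra_proper.
have cpt : compact `[- M, M]%classic by exact: segment_compact.
have FU : Filter U by typeclasses eauto.
have sK : (s @ U) `[- M, M]%classic.
  apply: (@filterS _ U FU setT) => [k _ /=|]; last exact: filterT.
  by rewrite in_itv /= -ler_norml.
have [l [_ hl]] := cpt (s @ U) _ sK.
exists l => e e0; have [//|nU] := in_ultra_setVsetC [set k | `|s k - l| < e] UU.
have /hl : (s @ U) [set y | ~ `|y - l| < e] by exact: nU.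
have /[swap]/[apply] : nbhs l (ball l e) by exact: nbhsx_ballx.
by move=> [y [/= + /= yb]]; case; rewrite distrC; move: yb; rewrite -ball_normE.
Qed.

Lemma complex_ultralimits (R : realType) : has_ultralimits (Cplx R).
Proof.
have [U [UU ooU]] := ultraFilterLemma (_ : ProperFilter \oo).
have PU : ProperFilter U by apply: ultra_proper.
have FU : Filter U by typeclasses eauto.
exists U; split => // s M sM.
have sM' k : toC `|complex.Re (s k)| <= M /\ toC `|complex.Im (s k)| <= M.
  by split; [apply: le_trans (abs_Re_le _) _|apply: le_trans (abs_Im_le _) _]; exact: sM.
have Mr : M = toC (complex.Re M).
  have : 0 <= M by apply: le_trans (sM 0%N).
  by case: (M) => a b; rewrite lecE /= => /andP[/eqP-> _].
have [a ha] := @real_ultralimit R U (fun k => complex.Re (s k)) (complex.Re M) UU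
   (fun k => ltac:(by have [+ _] := sM' k; rewrite Mr lecR)).
have [b hb] := @real_ultralimit R U (fun k => complex.Im (s k)) (complex.Re M) UU
   (fun k => ltac:(by have [_ +] := sM' k; rewrite Mr lecR)).
exists (Complex a b : Cplx R) => _ /toC_ltP[e e0 ->].
have e20 : 0 < e / 2 by rewrite divr_gt0.
apply: (@filterS _ U FU _ _ _ (@filterI _ U FU _ _ (ha _ e20) (hb _ e20))) => k [/= k1 k2].
apply: le_lt_trans (normC_le_ReIm _) _.
have := ltrD k1 k2; rewrite -splitr; rewrite -ltcR => h; apply: le_lt_trans h.
by case: (s k) {k1 k2} => [x1 x2] /=.
Qed.

Lemma complex_square_bd_compact (R : realType) : compact (@square_bd (Cplx R)).
Proof.
have pm1 (x : R) : (-1 <= toC x <= 1) = (-1 <= x <= 1).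
  have tN1 : @toC R (-1) = (-1 : Cplx R) by exact: (rmorphN1 (real_complex R)).
  by rewrite -tN1 !lecR.
pose seg l (y : R) : Cplx R := 'i ^+ l * (1 + 'i * toC y).
have edgeE l : @square_edge (Cplx R) l = seg l @` `[-1, 1]%classic.
  apply/seteqP; split => z.
    move=> [y hy ->]; have yr : y = toC (complex.Re y).
      by have := real_pm1 hy; case: (y) => a b; rewrite complex_real => /eqP ->.
    exists (complex.Re y); last by rewrite /seg -yr.
    by move: hy; rewrite yr pm1 /= in_itv.
  move=> [y hy <-]; exists (toC y) => //.
  by rewrite pm1; move: hy; rewrite /= in_itv.
have edge_compact l : compact (@square_edge (Cplx R) l).
  rewrite edgeE; apply: continuous_compact; last exact: segment_compact.
  apply: continuous_subspaceT => y.
  apply/cvgrPdist_lt => _ /toC_ltP[e e0 ->].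
  near=> y'.
  have -> : seg l y - seg l y' = 'i ^+ l * 'i * toC (y - y').
    by rewrite /seg /toC rmorphB /=; ring.
  rewrite !normrM norm_i_exp normCi !mul1r.
  have -> : `|toC (y - y')| = toC `|y - y'|.
    by rewrite [LHS](@normc_def R) /= expr0n addr0 sqrtr_sqr.
  rewrite ltcR; near: y'; by apply/nbhs_normP; exists e.
have -> : @square_bd (Cplx R) = @square_edge (Cplx R) 0 `|` @square_edge (Cplx R) 1 `|` (@square_edge (Cplx R) 2 `|` @square_edge (Cplx R) 3).
  have i4 k : ('i : Cplx R) ^+ (4 * k) = 1.
    by rewrite exprM (exprM 'i 2 2) sqrCi sqrrN expr1n expr1n.
  apply/seteqP; split => z.
    move=> [l [y hy ->]]; rewrite (divn_eq l 4) exprD mulnC i4 mul1r.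
    have : (l %% 4 < 4)%N by rewrite ltn_mod.
    case: (l %% 4)%N => [|[|[|[|//]]]] _.
    - by left; left; exists y.
    - by left; right; exists y.
    - by right; left; exists y.
    - by right; right; exists y.
  by move=> [[]|[]] h; [exists 0%N|exists 1%N|exists 2%N|exists 3%N].
by apply: compactU; apply: compactU; exact: edge_compact.
Unshelve. all: by end_near.
Qed.

(** * Power sums of roots and the theorem of Gleason, Kahane and Zelazko *)

Section PowerSums.
Variable F : fieldType.

(** Newton's identities for the first two power sums. *)
Lemma coef_prod_1subX (s : seq F) (q := \prod_(w <- s) (1 - w *: 'X)) :
  [/\ q`_0 = 1, q`_1 = - \sum_(w <- s) w &
      q`_2 *+ 2 = (\sum_(w <- s) w) ^+ 2 - \sum_(w <- s) w ^+ 2].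
Proof.
rewrite {}/q; elim: s => [|w s [IH0 IH1 IH2]].
  by rewrite !big_nil !coef1; split; rewrite ?oppr0 // mul0rn expr2 mul0r addr0.
rewrite !big_cons; set q := \prod_(_ <- s) _ in IH0 IH1 IH2 *.
have cf i : ((1 - w *: 'X) * q)`_i.+1 = q`_i.+1 - w * q`_i.
  by rewrite mulrBl mul1r coefB -scalerAl coefZ coefXM.
have c0 : ((1 - w *: 'X) * q)`_0 = q`_0.
  by rewrite mulrBl mul1r coefB -scalerAl coefZ coefXM /= mulr0 subr0.
rewrite c0 !cf mulrnBl IH2 IH0 IH1; split=> //; ring.
Qed.

(** Dividing each factor X - z by - z turns p into a product of factors 1 - X
    / z, as p(0) = 1. *)
Lemma power_sums_of_roots (p : {poly F}) (rs : seq F) :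
  p = lead_coef p *: \prod_(z <- rs) ('X - z%:P) -> p`_0 = 1 ->
  p`_1 = - \sum_(z <- rs) z^-1 /\
  p`_2 *+ 2 = (\sum_(z <- rs) z^-1) ^+ 2 - \sum_(z <- rs) z^-1 ^+ 2.
Proof.
move=> ep p0.
have rs0 z : z \in rs -> z != 0.
  move=> zrs; apply/eqP => z0; move: p0; rewrite ep -horner_coef0 hornerZ.
  have /rootP -> : root (\prod_(z <- rs) ('X - z%:P)) 0 by rewrite root_prod_XsubC -z0.
  by rewrite mulr0 => /esym/eqP; rewrite oner_eq0.
have eprod : \prod_(z <- rs) ('X - z%:P) = (\prod_(z <- rs) - z) *: \prod_(w <- map (fun z => z^-1) rs) (1 - w *: 'X).
  rewrite big_map; elim: rs rs0 {ep} => [|z rs IH] rs0; first by rewrite !big_nil scale1r.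
  rewrite !big_cons IH; last by move=> y yrs; apply: rs0; rewrite inE yrs orbT.
  have z0 : z != 0 by apply: rs0; rewrite inE eqxx.
  have -> : 'X - z%:P = (- z) *: (1 - z^-1 *: 'X).
    by rewrite scalerBr scalerA mulNr divff // scaleN1r opprK -alg_polyC scaleNr addrC.
  by rewrite -scalerAl -scalerAr scalerA.
have [q0 q1 q2] := coef_prod_1subX (map (fun z => z^-1) rs).
have eq : p = \prod_(w <- map (fun z => z^-1) rs) (1 - w *: 'X).
  move: p0; rewrite {1}ep eprod scalerA coefZ q0 mulr1 => c1.
  by rewrite {1}ep eprod scalerA c1 scale1r.
by rewrite eq q1 q2 !big_map.
Qed.

End PowerSums.

Section GKZ.
Variable C : numClosedFieldType.
Hypothesis half_pow_small : half_pow_null C.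
Variables (A : comAlgType C) (X : normedModType C) (pol : {linear A -> X}).

(** Cyclicity of pol f, expressed through the multiples of f in the algebra A
    of polynomials. *)
Definition cyclic_elt (f : A) := forall (x : X) (d : C), 0 < d -> exists b, `|x - pol (b * f)| < d.

(** If multiplication by a has norm at most 1/2, then multiplication by 1 - a
    has dense range: the partial sums of the Neumann series solve (1 - U) y =
    x up to U^n x. *)
Lemma cyclic_mul_near1 (U : {linear X -> X}) (a f : A) :
  (forall x, `|U x| <= `|x| / 2) -> (forall b, U (pol b) = pol (a * b)) ->
  cyclic_elt f -> cyclic_elt ((1 - a) * f).
Proof.
move=> Ule Upol cf x d d0.
have d20 : 0 < d / 2 by rewrite divr_gt0.
have [n hn] := half_pow_small (normr_ge0 x) d20.
have itle k : `|iter k U x| <= `|x| / 2 ^+ k.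
  elim: k => [|k IH] /=; first by rewrite expr0 divr1.
  apply: le_trans (Ule _) _; rewrite exprSr invfM mulrA ler_pM2r ?invr_gt0 //.
pose y := \sum_(k < n) iter k U x.
have ey : y - U y = x - iter n U x.
  rewrite /y; elim: n {hn y} => [|n IH]; first by rewrite big_ord0 linear0 !subrr.
  by rewrite big_ord_recr /= linearD opprD addrACA IH addrA subrK.
have d40 : 0 < d / 4 by rewrite divr_gt0.
have [b hb] := cf y _ d40; exists b.
have -> : pol (b * ((1 - a) * f)) = pol (b * f) - U (pol (b * f)).
  by rewrite Upol -raddfB /=; congr (pol _); ring.
have -> : x - (pol (b * f) - U (pol (b * f))) =
    iter n U x + ((y - pol (b * f)) - U (y - pol (b * f))).
  have -> : iter n U x = x - (y - U y) by rewrite ey opprB addrC subrK.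
  have -> : y - pol (b * f) - U (y - pol (b * f)) = (y - U y) - (pol (b * f) - U (pol (b * f))).
    by rewrite linearB !opprD !opprK addrACA.
  by rewrite addrA subrK.
apply: le_lt_trans (ler_normD _ _) _; rewrite [X in _ < X]splitr; apply: ltr_leD.
  exact: le_lt_trans (itle n) hn.
apply: le_trans (ler_normB _ _) _.
apply: (@le_trans _ _ (d / 4 + d / 4)); last by rewrite le_eqVlt; apply/orP; left; apply/eqP; field.
apply: lerD; first exact: ltW.
apply: le_trans (Ule _) _; apply: le_trans (ltW hb).
by rewrite ler_pdivrMr // ler_peMr // ler1n.
Qed.

Hypothesis pol_dense : cyclic_elt 1.
Hypothesis multipliers : forall a, exists2 S : {linear X -> X},
  forall b, S (pol b) = pol (a * b) & exists2 M : C, 0 <= M & forall x, `|S x| <= M * `|x|.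

Lemma cyclic_pow_near1 (a : A) : exists2 M : C, 0 < M &
  forall t : C, `|t| <= M^-1 -> forall n, cyclic_elt ((1 - t *: a) ^+ n).
Proof.
have [S Sa [M M0 SM]] := multipliers a.
have M1 : 0 < 2 * (M + 1) by rewrite mulr_gt0 // ltr_wpDl.
exists (2 * (M + 1)) => // t tM n.
pose U : {linear X -> X} := t \*: S.
elim: n => [|n IH]; first by rewrite expr0.
rewrite exprS; apply: (@cyclic_mul_near1 U) => // [x|b].
  rewrite /U /= normrZ; apply: (@le_trans _ _ ((2 * (M + 1))^-1 * ((M + 1) * `|x|))).
    apply: ler_pM => //; apply: le_trans (SM x) _.
    by rewrite ler_wpM2r // lerDl.
  rewrite le_eqVlt; apply/orP; left; apply/eqP; field.
  by rewrite gt_eqF // ltr_wpDl.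
by rewrite /U /= Sa -linearZ /= -scalerAl.
Qed.

Variable Lam : A -> C.
Hypothesis Lam_lin : forall (c : C) a b, Lam (c *: a + b) = c * Lam a + Lam b.
Hypothesis Lam1 : Lam 1 = 1.
Hypothesis Lam_cyclic : forall a, cyclic_elt a -> Lam a != 0.

Let Lam0 : Lam 0 = 0.
Proof.
have := Lam_lin 1 0 0; rewrite scaler0 addr0 mul1r => /(congr1 (fun x => x - Lam 0)).
by rewrite addrK subrr.
Qed.

Let LamZ c a : Lam (c *: a) = c * Lam a.
Proof. by have := Lam_lin c a 0; rewrite !addr0 Lam0 addr0. Qed.

Let LamD a b : Lam (a + b) = Lam a + Lam b.
Proof. by have := Lam_lin 1 a b; rewrite scale1r mul1r. Qed.

Let Lam_sum n (f : 'I_n -> A) : Lam (\sum_(i < n) f i) = \sum_(i < n) Lam (f i).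
Proof.
elim: n f => [|n IH] f; first by rewrite !big_ord0 Lam0.
by rewrite !big_ord_recr /= LamD IH.
Qed.

(** The polynomial p(t) = Lam ((1 - t a)^n) has no root of modulus at most 1 /
    M, and at most n roots. The left hand side is the sum of the squares of
    the inverses of its roots. *)
Lemma gkz_estimate (a : A) : exists M : C, forall n : nat,
  `|n%:R ^+ 2 * Lam a ^+ 2 - (n * n.-1)%:R * Lam (a ^+ 2)| <= n%:R * M.
Proof.
have [M M0 cM] := cyclic_pow_near1 a; exists (M ^+ 2) => n.
pose c k : C := (-1) ^+ k * Lam (a ^+ k) *+ 'C(n, k).
pose p : {poly C} := \poly_(k < n.+1) c k.
have pE t : p.[t] = Lam ((1 - t *: a) ^+ n).
  rewrite horner_poly exprDn Lam_sum; apply: eq_bigr => i _.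
  rewrite expr1n mul1r -scaleNr exprZn -scaler_nat !LamZ /c (exprNn t) -mulr_natl; ring.
have p0 : p`_0 = 1 by rewrite coef_poly /= /c !expr0 bin0 mul1r Lam1.
have [rs ep] := closed_field_poly_normal p.
have [p1 p2] := power_sums_of_roots ep p0.
have pn0 : p != 0 by apply/eqP => pz; move: p0; rewrite pz coef0 => /esym/eqP; rewrite oner_eq0.
have srs : (size rs <= n)%N.
  have : (size p <= n.+1)%N by exact: size_poly.
  by rewrite ep size_scale ?lead_coef_eq0 // size_prod_XsubC.
have rM z : z \in rs -> `|z^-1| <= M.
  move=> zrs; have rz : root p z by rewrite ep rootZ ?lead_coef_eq0 // root_prod_XsubC.
  rewrite real_leNgt ?normr_real ?gtr0_real //; apply/negP => h.
  have z0 : 0 < `|z| by rewrite -invr_gt0 -normfV (lt_trans M0).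
  have zM : `|z| <= M^-1.
    by rewrite -[X in X <= _]invrK lef_pV2 ?posrE ?invr_gt0 // -normfV ltW.
  by move: (Lam_cyclic (cM z zM n)); rewrite -pE; move/rootP: rz => ->; rewrite eqxx.
have c1 : p`_1 = - (n%:R * Lam a).
  case: n @c @p {pE p0 ep p1 p2 pn0 srs rM} => [|n] /=; rewrite coef_poly /=.
    by rewrite mul0r oppr0.
  by rewrite !expr1 bin1 mulN1r mulNrn mulr_natl.
have c2 : p`_2 *+ 2 = (n * n.-1)%:R * Lam (a ^+ 2).
  case: n @c @p {pE p0 ep p1 p2 pn0 srs rM c1} => [|[|n]] /=; rewrite coef_poly /=.
    by rewrite mul0r mul0rn.
    by rewrite mul0r mul0rn.
  rewrite sqrrN expr1n mul1r -mulrnA mulr_natl; congr (_ *+ _).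
  by rewrite -[2%N]/(2`!) bin_ffact !ffactnS ffactn0 muln1.
have -> : n%:R ^+ 2 * Lam a ^+ 2 - (n * n.-1)%:R * Lam (a ^+ 2) = \sum_(z <- rs) z^-1 ^+ 2.
  have e : \sum_(z <- rs) z^-1 = n%:R * Lam a by apply: oppr_inj; rewrite -p1 c1.
  by rewrite -c2 p2 e exprMn opprB addrC subrK.
have : `|\sum_(z <- rs) z^-1 ^+ 2| <= \sum_(z <- rs) M ^+ 2.
  apply: le_trans (ler_norm_sum _ _ _) _.
  rewrite big_seq [X in _ <= X]big_seq; apply: ler_sum => z zrs.
  by rewrite normrX lerXn2r ?nnegrE ?(ltW M0) // rM.
move=> /le_trans; apply; rewrite big_const_seq count_predT iter_addr_0 -[_ *+ size rs]mulr_natl.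
by rewrite ler_wpM2r ?exprn_ge0 ?(ltW M0) // ler_nat.
Qed.

(** Dividing [gkz_estimate] by n and letting n tend to infinity. *)
Lemma gkz_square (a : A) : Lam (a ^+ 2) = Lam a ^+ 2.
Proof.
have [M hM] := gkz_estimate a.
apply/eqP; rewrite -subr_eq0 -normr_le0 real_leNgt ?normr_real //; apply/negP => d0.
set d := `|_| in d0.
have B0 : 0 <= M + `|Lam (a ^+ 2)|.
  by rewrite addr_ge0 //; have := le_trans (normr_ge0 _) (hM 1%N); rewrite mul1r.
have [k hk] := half_pow_small B0 d0.
(* A large power of 2 as n in the estimate. *)
pose n := (2 ^ k)%N; have n0 : (0 < n)%N by rewrite expn_gt0.
suff : d < d by rewrite ltxx.
apply: le_lt_trans hk; rewrite ler_pdivlMr ?exprn_gt0 // -natrX -/n.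
have nn0 : 0 < (n%:R : C) by rewrite ltr0n.
rewrite -(ler_pM2r nn0).
have -> : d * n%:R * n%:R = `|(n%:R ^+ 2 * Lam a ^+ 2 - (n * n.-1)%:R * Lam (a ^+ 2)) - n%:R * Lam (a ^+ 2)|.
  rewrite -[n%:R in LHS]ger0_norm ?ler0n // /d -!normrM -normrN; congr `|_|.
  rewrite natrM -subn1 natrB //; ring.
apply: le_trans (ler_normB _ _) _; rewrite mulrDl [M * _]mulrC; apply: lerD => //.
by rewrite normrM normr_nat mulrC.
Qed.

Lemma gkz_mul (a b : A) : Lam (a * b) = Lam a * Lam b.
Proof.
have := gkz_square (a + b); rewrite sqrrD !LamD !gkz_square sqrrD.
rewrite !mulr2n ?LamD => /(congr1 (fun x => (x - Lam a ^+ 2 - Lam b ^+ 2) / 2)) h.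
have e (x y z : C) : (x + (y + y) + z - x - z) / 2 = y by field.
by move: h; rewrite !e.
Qed.

End GKZ.

(** * Bounded linear maps and density in terms of norms *)

Section LinearBounds.
Variable C : numClosedFieldType.
Variables V W : normedModType C.

Lemma bounded_nearE (L : {linear V -> W}) : bounded_near L (nbhs 0) ->
  exists2 M : C, 0 <= M & forall x, `|L x| <= M * `|x|.
Proof.
move=> /linear_boundedP [r [rr h]].
exists (`|r| + 1) => [|x]; first by rewrite addr_ge0.
by apply: h; apply: le_lt_trans (real_ler_norm rr) _; rewrite ltrDl.
Qed.

Lemma bounded_nearI (L : V -> W) (M : C) : 0 <= M -> (forall x, `|L x| <= M * `|x|) ->
  bounded_near L (nbhs 0).
Proof.
move=> M0 hM; apply/ex_bound; exists M; apply/nbhs_norm0P; exists 1 => //= x x1.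
by apply: le_trans (hM x) _; rewrite ler_piMr // ltW.
Qed.

Lemma norm_dense_nbhs (S : set V) : dense S ->
  forall x (d : C), 0 < d -> exists2 y, S y & `|x - y| < d.
Proof.
move=> dS x d d0.
have bx : ball x d !=set0 by exists x; exact: ballxx.
have [y [yb Sy]] := dS _ bx (ball_open x d).
by exists y => //; move: yb; rewrite -ball_normE.
Qed.

Lemma closure_dist (S : set V) x : closure S x -> forall d : C, 0 < d ->
  exists2 y, S y & `|x - y| < d.
Proof.
move=> cx d d0; have [y [Sy yb]] := cx _ (nbhsx_ballx x _ d0).
by exists y => //; move: yb; rewrite -ball_normE.
Qed.

Lemma closure_setT_dist (S : set V) :
  (forall x (d : C), 0 < d -> exists2 y, S y & `|x - y| < d) -> closure S = setT.
Proof.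
move=> h; rewrite -subTset => x _ B /nbhs_normP[d d0 hd].
by have [y Sy yx] := h x d d0; exists y; split => //; apply: hd.
Qed.

End LinearBounds.

(** * Polynomials in a Banach space of holomorphic functions *)

Section PolynomialFunctions.
Variables (R : realType) (n : nat).
Local Notation C := (Cplx R).
Implicit Types p q : mpoly n C.

Lemma mpoly_funD p q z : mpoly_fun (p + q) z = mpoly_fun p z + mpoly_fun q z.
Proof. exact: mevalD. Qed.
Lemma mpoly_funZ c p z : mpoly_fun (c *: p) z = c * mpoly_fun p z.
Proof. exact: mevalZ. Qed.
Lemma mpoly_funM p q z : mpoly_fun (p * q) z = mpoly_fun p z * mpoly_fun q z.
Proof. exact: mevalM. Qed.
Lemma mpoly_fun1 z : mpoly_fun (1 : mpoly n C) z = 1.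
Proof. exact: meval1. Qed.
Lemma mpoly_funX m z : mpoly_fun (mpolyX C m) z = \prod_(i < n) z ord0 i ^+ m i.
Proof. exact: mevalX. Qed.
Lemma mpoly_funXi (i : 'I_n) z : mpoly_fun (mpolyX C (mnm1 i)) z = z ord0 i.
Proof. exact: mevalXU. Qed.

Lemma mpoly_mul_ind (Q : mpoly n C -> Prop) : Q 1 -> (forall i, Q (mpolyX C (mnm1 i))) ->
  (forall c p q, Q p -> Q q -> Q (c *: p + q)) -> (forall p q, Q p -> Q q -> Q (p * q)) ->
  forall p, Q p.
Proof.
move=> Q1 QX QD QM.
have Q0 : Q 0 by have := QD (-1) 1 1 Q1 Q1; rewrite scaleN1r addNr.
have Qe p k : Q p -> Q (p ^+ k).
  by move=> Qp; elim: k => [|k IH]; rewrite ?expr0 // exprS; apply: QM.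
apply: mpolyind => // c m p _ _ Qp; apply: QD => //.
rewrite mpolyXE_id; apply: big_ind => [|p1 p2 h1 h2|i _].
- exact: Q1.
- exact: QM.
exact: Qe.
Qed.

Lemma mpoly_fun_differentiable p z : differentiable (mpoly_fun p) z.
Proof.
elim/mpoly_mul_ind: p => [|i|c p q dp dq|p q dp dq].
- by rewrite (_ : mpoly_fun 1 = cst 1) //; apply/funext => w; exact: mpoly_fun1.
- rewrite (_ : mpoly_fun _ = fun w : 'rV[C]_n => w ord0 i); last by apply/funext => w; exact: mpoly_funXi.
  exact: differentiable_coord.
- have -> : mpoly_fun (c *: p + q) = fun w => c * mpoly_fun p w + mpoly_fun q w.
    by apply/funext => w; rewrite mpoly_funD mpoly_funZ.
  exact: differentiable_lin.
have -> : mpoly_fun (p * q) = fun w => mpoly_fun p w * mpoly_fun q w.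
  by apply/funext => w; rewrite mpoly_funM.
exact: differentiable_mul.
Qed.

End PolynomialFunctions.

Section PolynomialSpace.
Variables (R : realType) (n : nat) (D : set 'rV[Cplx R]_n) (X : holSpace D).
Local Notation C := (Cplx R).
Hypotheses (X_P1 : P1 X) (X_P3 : P3 X).

Lemma represents_uniq (f g : X) h : represents f h -> represents g h -> f = g.
Proof. by move=> fh gh; apply: ev_inj => z Dz; rewrite fh // gh. Qed.

Lemma elt_ofP (f : X) h : represents f h -> elt_of X h = f.
Proof.
move=> fh; apply: (@represents_uniq _ _ h) => //.
by apply: (@xgetPex _ 0 [set f : X | represents f h]); exists f.
Qed.

Definition poly_elt (p : mpoly n C) : X := elt_of X (mpoly_fun p).

Lemma ev_poly_elt p : represents (poly_elt p) (mpoly_fun p).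
Proof. by have [f fp] := X_P1.1 p; rewrite /poly_elt (elt_ofP fp). Qed.

Lemma poly_elt_linear : linear poly_elt.
Proof.
move=> c p q; apply: elt_ofP => z Dz.
by rewrite ev_linear // !ev_poly_elt // mpoly_funD mpoly_funZ.
Qed.

(** The map [poly_elt] packed as a linear map; the packing depends on P1,
    which provides the elements of X that represent polynomials. *)
Definition poly_linear : {linear mpoly n C -> X} :=
  HB.pack poly_elt (GRing.isLinear.Build _ _ _ _ poly_elt poly_elt_linear).

Lemma polynomial_multiplier p : exists2 S : {linear X -> X},
  (forall f z, D z -> ev (S f) z = mpoly_fun p z * ev f z) &
  exists2 M : C, 0 <= M & forall f, `|S f| <= M * `|f|.
Proof.
elim/mpoly_mul_ind: p => [|i|c p q [S Sp [M M0 SM]] [T Tq [N N0 TN]]|p q [S Sp [M M0 SM]] [T Tq [N N0 TN]]].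
- exists idfun; first by move=> f z Dz; rewrite mpoly_fun1 mul1r.
  by exists 1 => // f; rewrite mul1r.
- have [S [Si /bounded_nearE hS]] := X_P3 i; exists S => // f z Dz.
  by rewrite Si // mpoly_funXi.
- exists ((c \*: S) \+ T : {linear X -> X}).
    move=> f z Dz; rewrite /= ev_linear // Sp // Tq // mpoly_funD mpoly_funZ; ring.
  exists (`|c| * M + N) => [|f]; first by rewrite addr_ge0 // mulr_ge0.
  rewrite mulrDl; apply: le_trans (ler_normD _ _) _; apply: lerD; last exact: TN.
  by rewrite normrZ -mulrA ler_wpM2l.
exists (S \o T : {linear X -> X}).
  by move=> f z Dz; rewrite /= Sp // Tq // mpoly_funM mulrA.
exists (M * N) => [|f]; first by rewrite mulr_ge0.
by rewrite /=; apply: le_trans (SM _) _; rewrite -mulrA ler_wpM2l.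
Qed.

Lemma poly_elt_multiplier p : exists2 S : {linear X -> X},
  forall q, S (poly_elt q) = poly_elt (p * q) &
  exists2 M : C, 0 <= M & forall x, `|S x| <= M * `|x|.
Proof.
have [S Sp hS] := polynomial_multiplier p; exists S => // q.
apply: ev_inj => z Dz; rewrite Sp // !ev_poly_elt //; exact/esym/mpoly_funM.
Qed.

Lemma poly_elt_dense : @cyclic_elt C (mpoly n C) X poly_linear 1.
Proof.
move=> x d d0; have [y [p py] yx] := norm_dense_nbhs X_P1.2 x d0.
move: yx; rewrite -(represents_uniq (ev_poly_elt p) py) => yx.
by exists p; rewrite mulr1; exact: yx.
Qed.

Lemma cyclic_elt_fun p : @cyclic_elt C (mpoly n C) X poly_linear p -> cyclic_fun (poly_elt p).
Proof.
move=> cp; apply: closure_setT_dist => x d d0; have [b hb] := cp x d d0.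
exists (poly_linear (b * p)) => //.
have -> : poly_linear (b * p) = \sum_(m <- msupp b) mcoeff m b *: poly_linear (mpolyX C m * p).
  transitivity (poly_linear ((\sum_(m <- msupp b) mcoeff m b *: mpolyX C m) * p)).
    by rewrite -mpolyE.
  by rewrite mulr_suml linear_sum; apply: eq_bigr => m _; rewrite -scalerAl linearZ.
rewrite big_tnth; exists (size (msupp b)), (fun i => mcoeff (tnth (in_tuple (msupp b)) i) b),
  (fun i => poly_elt (mpolyX C (tnth (in_tuple (msupp b)) i) * p)); split => // i.
exists (fun j => tnth (in_tuple (msupp b)) i j) => z Dz.
by rewrite !ev_poly_elt // mpoly_funM mpoly_funX.
Qed.

End PolynomialSpace.

Section CyclicElements.
Variables (R : realType) (m : nat) (E : set 'rV[Cplx R]_m) (Y : holSpace E).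
Local Notation C := (Cplx R).
Hypothesis Y_P2 : P2 Y.

Lemma evaluation_bounded u : E u ->
  exists2 M : C, 0 <= M & forall h : Y, `|ev h u| <= M * `|h|.
Proof.
move=> Eu; have lin : linear (fun h : Y => ev h u).
  by move=> c f k; rewrite ev_linear.
pose L : {linear Y -> C} := HB.pack (fun h : Y => ev h u) (GRing.isLinear.Build _ _ _ _ _ lin).
exact: (@bounded_nearE C Y C L (Y_P2 Eu)).
Qed.

(** The linear span of the monomial multiples of f consists of the multiples
    of f by polynomials. *)
Lemma cyclic_multiples (f : Y) : cyclic_fun f -> forall (h : Y) (d : C), 0 < d ->
  exists q h', @multiple C 'rV[C]_m Y E (fun u k => ev k u) (fun u => ev f u)
     [set q | forall w, differentiable q w] q h' /\ `|h - h'| < d.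
Proof.
move=> cf h d d0.
have hcl : closure (lin_span [set g : Y | exists alpha : 'I_m -> nat,
    represents g (fun z => (\prod_(i < m) z ord0 i ^+ alpha i) * ev f z)]) h.
  by rewrite [closure _]cf.
have [v [k [c [a [ha ev_]]]] hv] := closure_dist hcl d0.
have [alpha hal] := choice ha.
pose q (w : 'rV[C]_m) := \sum_(i < k) c i * \prod_(j < m) w ord0 j ^+ alpha i j.
exists q, v; split => //; split.
  move=> w /=; rewrite (_ : q = mpoly_fun (\sum_(i < k) c i *: mpolyX C (Multinom [tuple alpha i j | j < m]))).
    exact: mpoly_fun_differentiable.
  apply/funext => z; rewrite /q /mpoly_fun raddf_sum /=; apply: eq_bigr => i _.
  rewrite mevalZ mevalX; congr (_ * _); apply: eq_bigr => j _; by rewrite mnmE.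
move=> w Ew; rewrite ev_.
have -> : ev (\sum_(i < k) c i *: a i) w = \sum_(i < k) c i * ev (a i) w.
  have lin : linear (fun h : Y => ev h w) by move=> b x y; rewrite ev_linear.
  pose L : {linear Y -> C} := HB.pack (fun h : Y => ev h w) (GRing.isLinear.Build _ _ _ _ _ lin).
  by rewrite -[LHS]/(L _) linear_sum; apply: eq_bigr => i _; rewrite linearZ.
rewrite /q mulr_suml; apply: eq_bigr => i _.
by rewrite hal // mulrA.
Qed.

(** A zero of a cyclic function is a common zero of the whole space, since
    evaluation is continuous. *)
Lemma cyclic_zero (f : Y) u : E u -> cyclic_fun f -> ev f u = 0 -> forall h : Y, ev h u = 0.
Proof.
move=> Eu cf fu h; have [M M0 hM] := evaluation_bounded Eu.
apply/eqP; rewrite -normr_le0 real_leNgt ?normr_real //; apply/negP => e0.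
have M1 : 0 < M + 1 by rewrite ltr_wpDl.
have d0 : 0 < `|ev h u| / (M + 1) by rewrite divr_gt0.
have [q [h' [[_ hq] hh]]] := cyclic_multiples cf h d0.
have h0 : ev h' u = 0 by rewrite hq // fu mulr0.
have e : ev h u = ev (h - h') u.
  have -> : h - h' = (-1) *: h' + h by rewrite scaleN1r addrC.
  by rewrite ev_linear // h0 mulr0 add0r.
suff : `|ev h u| < `|ev h u| by rewrite ltxx.
rewrite {1}e; apply: le_lt_trans (hM _) _.
apply: (@le_lt_trans _ _ ((M + 1) * `|h - h'|)); first by rewrite ler_wpM2r // lerDl.
by rewrite mulrC -ltr_pdivlMr.
Qed.

End CyclicElements.

Section PolynomialCharacter.
Variables (R : realType) (n : nat) (D : set 'rV[Cplx R]_n) (X : holSpace D).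
Local Notation C := (Cplx R).
Hypotheses (X_P1 : P1 X) (X_P3 : P3 X).

(** A character of the polynomial algebra is determined by the images of the
    coordinate functions. *)
Lemma character_is_evaluation (Lam : mpoly n C -> C) :
  (forall c p q, Lam (c *: p + q) = c * Lam p + Lam q) -> Lam 1 = 1 ->
  (forall p, cyclic_fun (poly_elt X p) -> Lam p != 0) ->
  forall p, Lam p = mpoly_fun p (\row_i Lam (mpolyX C (mnm1 i))).
Proof.
move=> Llin L1 Lc.
have Lmul p q : Lam (p * q) = Lam p * Lam q.
  apply: (@gkz_mul C (@complex_half_pow_null R) (mpoly n C) X (poly_linear X_P1)) => //.
  - exact: poly_elt_dense.
  - exact: poly_elt_multiplier.
  - by move=> a ca; apply: Lc; exact: cyclic_elt_fun.
elim/mpoly_mul_ind => [|i|c p q hp hq|p q hp hq].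
- by rewrite L1 mpoly_fun1.
- by rewrite mpoly_funXi mxE.
- by rewrite Llin mpoly_funD mpoly_funZ -hp -hq.
by rewrite Lmul mpoly_funM -hp -hq.
Qed.

End PolynomialCharacter.

Section MaximalDomain.
Variables (R : realType) (n : nat) (D : set 'rV[Cplx R]_n) (X : holSpace D).
Local Notation C := (Cplx R).
Hypothesis X_P1 : P1 X.

(** Bounded functionals that agree on the dense set of polynomials are equal. *)
Lemma eval_extension_uniq w (L L' : X -> C) : eval_extension w L -> eval_extension w L' -> L = L'.
Proof.
move=> [linL bL pL] [linL' bL' pL'].
pose F : {linear X -> C} := HB.pack L (GRing.isLinear.Build _ _ _ _ L linL).
pose F' : {linear X -> C} := HB.pack L' (GRing.isLinear.Build _ _ _ _ L' linL').
have [M M0 hM] := @bounded_nearE C X C F bL.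
have [M' M'0 hM'] := @bounded_nearE C X C F' bL'.
apply/funext => x; apply/eqP; rewrite -subr_eq0 -normr_le0 real_leNgt ?normr_real //.
apply/negP => e0; have MM : 0 < M + M' + 1 by rewrite ltr_wpDl // addr_ge0.
have d0 : 0 < `|L x - L' x| / (M + M' + 1) by rewrite divr_gt0.
have [p hp] := poly_elt_dense X_P1 x d0.
rewrite mulr1 in hp; set y : X := poly_linear X_P1 p in hp.
have ey : F y = F' y.
  have yp : represents y (mpoly_fun p) by exact: ev_poly_elt.
  by rewrite /= (pL _ _ yp) (pL' _ _ yp).
have e : L x - L' x = F (x - y) - F' (x - y).
  by rewrite (linearB F x y) (linearB F' x y) ey opprB addrA subrK.
suff : `|L x - L' x| < `|L x - L' x| by rewrite ltxx.
rewrite {1}e; apply: le_lt_trans (ler_normB _ _) _.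
apply: le_lt_trans (lerD (hM _) (hM' _)) _; rewrite -mulrDl.
apply: (@le_lt_trans _ _ ((M + M' + 1) * `|x - y|)).
  by rewrite ler_wpM2r // lerDl.
by rewrite mulrC -ltr_pdivlMr.
Qed.

Lemma hatE w (L : X -> C) f : eval_extension w L -> hat f w = L f.
Proof.
move=> hL; rewrite /hat (eval_extension_uniq (L := Lambda w) (L' := L) (w := w)) //.
by apply: (@xgetPex _ (fun=> 0) [set L : X -> C | eval_extension w L]); exists L.
Qed.

Lemma represents_poly_elt p (f : X) : represents f (mpoly_fun p) -> f = poly_elt X p.
Proof. by move=> fp; apply: (represents_uniq fp); exact: ev_poly_elt. Qed.

End MaximalDomain.

(** * Operators preserving cyclic functions *)

Section WeightedComposition.
Variables (R : realType) (n m : nat).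
Local Notation C := (Cplx R).
Variables (D : set 'rV[C]_n) (X : holSpace D) (E : set 'rV[C]_m) (Y : holSpace E).
Hypotheses (X_P1 : P1 X) (X_P3 : P3 X) (openE : open E) (Y_P2 : P2 Y).
Variable T : {linear X -> Y}.
Hypothesis T_cyclic : forall f : X, cyclic_fun f -> cyclic_fun (T f).

Let g (u : 'rV[C]_m) : C := ev (T (poly_elt X 1)) u.
Let z_ (i : 'I_n) : X := poly_elt X (mpolyX C (mnm1 i)).

Lemma poly1_cyclic : cyclic_fun (poly_elt X 1).
Proof. by apply: (@cyclic_elt_fun _ _ _ _ X_P1); exact: poly_elt_dense. Qed.

Lemma evaluation_quotient u : E u -> g u != 0 -> forall p,
  ev (T (poly_elt X p)) u / g u = mpoly_fun p (\row_i (ev (T (z_ i)) u / g u)).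
Proof.
move=> Eu gu p.
apply: (character_is_evaluation X_P1 X_P3 (Lam := fun p => ev (T (poly_elt X p)) u / g u)).
- move=> c p1 p2; have -> : poly_elt X (c *: p1 + p2) = c *: poly_elt X p1 + poly_elt X p2.
    exact: (poly_elt_linear X_P1).
  by rewrite linearP ev_linear // mulrDl mulrA.
- exact: divff.
move=> p1 cp; apply: mulf_neq0; last by rewrite invr_eq0; exact: gu.
apply/eqP => h0.
have := cyclic_zero Y_P2 Eu (T_cyclic cp) h0 (T (poly_elt X 1)).
by move/eqP; rewrite (negPf gu).
Qed.

Let ev_fun (u : 'rV[C]_m) (h : Y) : C := ev h u.
Let entire : set ('rV[C]_m -> C) := [set q | forall w, differentiable q w].

Let ev_fun_lin u : E u -> forall (c : C) h k, ev_fun u (c *: h + k) = c * ev_fun u h + ev_fun u k.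
Proof. by move=> Eu c h k; exact: ev_linear. Qed.

Let ev_fun_diff (h : Y) u : E u -> differentiable (fun w => ev_fun w h) u.
Proof. exact: ev_holomorphic. Qed.

Let entire_lin (c : C) q q' : entire q -> entire q' -> entire (fun w => c * q w + q' w).
Proof. by move=> eq eq' w; apply: differentiable_lin; [exact: eq|exact: eq']. Qed.

Let nondeg u := not_locally_null E g u.

Let dense_multiples := cyclic_multiples (T_cyclic poly1_cyclic).

Lemma not_locally_null_near u : nondeg u ->
  exists2 r : C, 0 < r & forall w, `|w - u| < r -> nondeg w.
Proof.
move=> nu.
have [r [K [r0 _ hr]]] := @multiple_le C (@complex_half_pow_null R) (@complex_complete R)
  (@complex_ultralimits R) (@complex_square_bd_compact R) 'rV[C]_m Y E ev_fun (@banach_complete _ Y)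
  openE ev_fun_lin (@evaluation_bounded _ _ _ _ Y_P2) ev_fun_diff g entire
  (@ev_fun_diff (T (poly_elt X 1))) (fun q eq => eq) u nu.
by exists r; [exact: r0 | move=> w /hr[nw _]; exact: nw].
Qed.

(** At points where T1 vanishes the last identity follows by continuity from
    [evaluation_quotient], as such points are limits of points where T1 does
    not vanish. *)
Lemma weighted_composition_symbol : exists theta : 'rV[C]_m -> Y -> C, forall u, nondeg u ->
  [/\ forall (c : C) h k, theta u (c *: h + k) = c * theta u h + theta u k,
      exists2 K : C, 0 <= K & forall h, `|theta u h| <= K * `|h|,
      forall h, g u * theta u h = ev h u,
      forall h, differentiable (fun w => theta w h) u &
      forall p, theta u (T (poly_elt X p)) = mpoly_fun p (\row_i theta u (T (z_ i)))].
Proof.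
have [theta ht] := @quotient_functional C (@complex_half_pow_null R) (@complex_complete R)
  (@complex_ultralimits R) (@complex_square_bd_compact R) 'rV[C]_m Y E ev_fun (@banach_complete _ Y)
  openE ev_fun_lin (@evaluation_bounded _ _ _ _ Y_P2) ev_fun_diff g entire
  (@ev_fun_diff (T (poly_elt X 1))) (fun q eq => eq) entire_lin dense_multiples.
exists theta => u nu; have [h1 h2 h3 h4] := ht u nu; split=> // p.
pose b w := \row_i theta w (T (z_ i)).
(* Differentiable near u, and zero at the points w with g w <> 0. *)
pose phi w := (-1) * mpoly_fun p (b w) + theta w (T (poly_elt X p)).
suff : phi u = 0 by move/eqP; rewrite /phi mulN1r addrC subr_eq0 => /eqP.
have dphi : differentiable phi u.
  apply: differentiable_lin; last exact: h4.
  apply: (@differentiable_comp _ _ _ _ b (mpoly_fun p)); last exact: mpoly_fun_differentiable.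
  by apply: differentiable_row => i; exact: h4.
apply/eqP/negPn/negP => phi0.
have phi_pos : 0 < `|phi u| by rewrite normr_gt0.
have [r r0 hr] := differentiable_near dphi phi_pos.
have [s s0 hs] := not_locally_null_near nu.
have [t [t0 tr ts]] := min_pos r0 s0.
have [w wt gw] := nu.2 t t0.
have nw : nondeg w by apply: hs; exact: lt_le_trans wt ts.
have [_ _ k3 _] := ht w nw.
have quo h : theta w h = ev h w / g w.
  by rewrite -[ev h w]k3 mulrC mulKf.
have phiw : phi w = 0.
  rewrite /phi quo (evaluation_quotient nw.1 gw) mulN1r.
  rewrite (_ : b w = \row_i (ev (T (z_ i)) w / g w)) ?addNr //.
  by apply/rowP => i; rewrite !mxE; exact: quo.
have := hr w (lt_le_trans wt tr); rewrite phiw sub0r normrN.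
by rewrite ltxx.
Qed.

Lemma locally_null_near u : E u -> ~ nondeg u ->
  exists2 r : C, 0 < r & forall w, `|w - u| < r -> ~ nondeg w.
Proof.
move=> Eu nu.
have [d d0 hd] : exists2 d : C, 0 < d & forall w, `|w - u| < d -> g w = 0.
  apply: contrapT => nd; apply: nu; split => // d d0.
  apply: contrapT => nw; apply: nd; exists d => // w wd.
  by apply: contrapT => /eqP gw; apply: nw; exists w.
have d20 : 0 < d / 2 by rewrite divr_gt0.
exists (d / 2); first exact: d20.
move=> w wu [Ew /(_ _ d20)[w' ww' /eqP]]; apply; apply: hd.
apply: le_lt_trans (ler_distD w _ _) _; rewrite [X in _ < X]splitr.
exact: ltrD.
Qed.

End WeightedComposition.

Theorem theorem4p4 (R : realType) (n m : nat)
    (D : set 'rV[Cplx R]_n) (openD : open D) (D_neq0 : D !=set0)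
    (X : holSpace D) (X_P1 : P1 X) (X_P2 : P2 X) (X_P3 : P3 X)
    (E : set 'rV[Cplx R]_m) (openE : open E)
    (Y : holSpace E) (Y_P2 : P2 Y) (Y_P3 : P3 Y)
    (T : {linear X -> Y}) (T_bounded : bounded_near T (nbhs 0))
    (T_cyclic : forall f : X, cyclic_fun f -> cyclic_fun (T f)) :
  let T1 : Y := T (elt_of X (fun=> 1)) in
  let Tz (i : 'I_n) : Y := T (elt_of X (fun z => z ord0 i)) in
  exists (a : Y) (b : 'rV[Cplx R]_m -> 'rV[Cplx R]_n),
    [/\ holomorphic_on E b,
        forall u, E u -> max_domain X (b u) &
        forall (f : X) u, E u -> ev (T f) u = ev a u * hat f (b u)] /\
    [/\ a = T1,
        cyclic_fun a &
        forall u, E u -> ev T1 u != 0 ->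
          b u = \row_(i < n) (ev (Tz i) u / ev T1 u)].
Proof.
move=> T1 Tz.
have e1 : elt_of X (fun=> 1) = poly_elt X 1.
  apply: elt_ofP => z Dz; rewrite (ev_poly_elt X_P1) //; exact: mpoly_fun1.
have ez i : elt_of X (fun z => z ord0 i) = poly_elt X (mpolyX (Cplx R) (mnm1 i)).
  apply: elt_ofP => z Dz; rewrite (ev_poly_elt X_P1) //; exact: mpoly_funXi.
have eT1 : T1 = T (poly_elt X 1) by rewrite /T1 e1.
pose g (u : 'rV[Cplx R]_m) := ev (T (poly_elt X 1)) u.
pose nondeg u := not_locally_null E g u.
have [theta ht] := weighted_composition_symbol X_P1 X_P3 openE Y_P2 T_cyclic.
have [z0 Dz0] := D_neq0.
(* Where T1 vanishes identically nearby, any point of D serves as a value. *)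
pose b u := if `[< nondeg u >] then \row_i theta u (Tz i) else z0.
have bE u : nondeg u -> b u = \row_i theta u (T (poly_elt X (mpolyX (Cplx R) (mnm1 i)))).
  by move=> nu; rewrite /b asboolT //; apply/rowP => i; rewrite !mxE /Tz ez.
have T1_cyclic : cyclic_fun T1 by rewrite eT1; apply: T_cyclic; exact: poly1_cyclic.
have [B B0 TB] := bounded_nearE T_bounded.
have extension u : E u -> exists L, eval_extension (b u) L /\
    forall f : X, ev (T f) u = ev T1 u * L f.
  move=> Eu; have [nu|nu] := pselect (nondeg u).
    have [th_lin [K K0 hK] th_g _ th_p] := ht u nu.
    exists (fun f => theta u (T f)); split; last first.
      by move=> f; rewrite eT1 -th_g.
    split.
    - by move=> c f h; rewrite linearP th_lin.
    - apply: (@bounded_nearI _ _ _ _ (K * B)); first exact: mulr_ge0.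
      move=> f; apply: le_trans (hK _) _; rewrite -mulrA; apply: ler_wpM2l => //.
    - by move=> p f fp; rewrite (represents_poly_elt X_P1 fp) th_p bE.
  have gu : ev T1 u = 0.
    rewrite eT1; apply: contrapT => /eqP gu; apply: nu; split => // d d0; exists u => //.
    by rewrite subrr normr0.
  exists (fun f => ev f z0); split; last first.
    by move=> f; rewrite gu mul0r; exact: (cyclic_zero Y_P2 Eu T1_cyclic gu).
  rewrite /b asboolF //; split.
  - by move=> c f h; rewrite ev_linear.
  - exact: X_P2.
  - by move=> p f fp; exact: fp.
exists T1, b; split; split.
- move=> u Eu; have [nu|nu] := pselect (nondeg u).
    have [r r0 hr] := not_locally_null_near openE Y_P2 nu.
    apply: (near_differentiable (f := fun w => \row_i theta w (Tz i)) r0).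
      by move=> w /hr nw; rewrite /b asboolT.
    by apply: (differentiable_row (f := fun i w => theta w (Tz i))) => i; have [_ _ _ h _] := ht u nu; exact: h.
  have [r r0 hr] := locally_null_near Eu nu.
  apply: (near_differentiable (f := cst z0) r0); last exact: differentiable_cst.
  by move=> w /hr nw; rewrite /b asboolF.
- by move=> u /extension[L [hL _]]; exists L.
- by move=> f u /extension[L [hL ->]]; rewrite (hatE X_P1 f hL).
- by [].
- exact: T1_cyclic.
move=> u Eu; rewrite eT1 => gu.
have nu : nondeg u by split => // d d0; exists u => //; rewrite subrr normr0.
rewrite bE //; apply/rowP => i; rewrite !mxE.
have [_ _ th_g _ _] := ht u nu.
by rewrite /Tz ez -(th_g (T (poly_elt X _))) mulrC mulKf.
Qed.
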